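(* Let $G_m$ be a bounded Vilenkin group, $R:=\sup_{k\in\mathbb{N}}m_k<\infty$, and let $t_n$ be the Nörlund means generated by a non-decreasing sequence $\{q_k:k\in\mathbb{N}\}$ (of nonnegative numbers with $q_0>0$ and $Q_n\to\infty$) such that the Nörlund method is regular. Let $1\le p<\infty$, $f\in L^p(G_m)$, $N\in\mathbb{N}$ and $M_N\le n<M_{N+1}$. Then $$\Vert t_nf-f\Vert_p\le \frac{3R^3}{Q_n}\sum_{i=0}^{N-1}M_i\,q_{n-M_i}\,\omega_p\left(\frac{1}{M_i},f\right)+2R^3\,\omega_p\left(\frac{1}{M_N},f\right).$$
   Context: $\mathbb{N}_+$ is the set of positive integers and $\mathbb{N}=\mathbb{N}_+\cup\{0\}$. Let $m=(m_0,m_1,\dots)$ be a sequence of integers $\ge 2$ with $R:=\sup_k m_k<\infty$ (bounded case). $Z_{m_k}=\{0,1,\dots,m_k-1\}$ is the additive group of integers modulo $m_k$, and $G_m=\prod_{k\ge0}Z_{m_k}$ is the complete direct product with the product of the discrete topologies; elements are $x=(x_0,x_1,\dots)$ with $x_k\in Z_{m_k}$. The Haar measure $\mu$ on $G_m$, with $\mu(G_m)=1$, is the product of the uniform measures $\mu_k(\{j\})=1/m_k$. Put $M_0=1$, $M_{k+1}=m_kM_k$. Every $n\in\mathbb{N}$ is uniquely $n=\sum_{j\ge0}n_jM_j$ with $n_j\in Z_{m_j}$, only finitely many nonzero. Generalized Rademacher functions: $r_k(x)=\exp(2\pi i x_k/m_k)$. Vilenkin system: $\psi_n(x)=\prod_{k\ge0}r_k(x)^{n_k}$,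 $n\in\mathbb{N}$. For $f\in L^1(G_m)$: $\widehat f(k)=\int_{G_m}f\,\overline{\psi_k}\,d\mu$, $S_nf=\sum_{k=0}^{n-1}\widehat f(k)\psi_k$ ($n\in\mathbb{N}_+$), $S_0f=0$. $\Vert f\Vert_p=(\int_{G_m}|f|^p\,d\mu)^{1/p}$. Nörlund means: for a sequence $\{q_k:k\ge0\}$ of nonnegative numbers with $q_0>0$, put $Q_n=\sum_{k=0}^{n-1}q_k$ and assume $\lim_{n\to\infty}Q_n=\infty$; then $t_nf=\frac{1}{Q_n}\sum_{k=1}^{n}q_{n-k}S_kf$ for $n\in\mathbb{N}_+$. The method is regular if and only if $\lim_{n\to\infty}q_{n-1}/Q_n=0$. Modulus of continuity: $\omega_p(\delta,f)=\sup_{|t|<\delta}\Vert f(\cdot+t)-f(\cdot)\Vert_p$ for $\delta>0$, where $+$ is the group operation of $G_m$ and $|t|=\sum_{k\ge0}t_k/M_{k+1}$ for $t=(t_0,t_1,\dots)\in G_m$. *)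

(* Defs.v *)
From HB Require Import structures.
From mathcomp Require Import all_boot all_order all_algebra.
From mathcomp Require Import all_classical all_reals all_analysis.
From mathcomp Require Import ring lra.
From mathcomp.real_closed Require Import complex.

Set Implicit Arguments.
Unset Strict Implicit.
Unset Printing Implicit Defensive.

Import Order.TTheory GRing.Theory Num.Theory numFieldNormedType.Exports.

Local Open Scope classical_set_scope.
Local Open Scope ring_scope.
Local Open Scope complex_scope.

(* ['Z_k] is the additive group of integers modulo [k] only when [1 < k];
   [vilenkin m] is meaningful when all [m k] are at least 2. *)
Definition vilenkin (m : nat -> nat) : Type := forall k : nat, 'Z_(m k).

HB.instance Definition _ (m : nat -> nat) := gen_eqMixin (vilenkin m).
HB.instance Definition _ (m : nat -> nat) := gen_choiceMixin (vilenkin m).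

Section group.
Variable m : nat -> nat.
Implicit Types x y z : vilenkin m.

Definition vzero : vilenkin m := fun=> 0.
Definition vopp x : vilenkin m := fun k => - x k.
Definition vadd x y : vilenkin m := fun k => x k + y k.

Lemma vaddA : associative vadd.
Proof. by move=> x y z; apply: functional_extensionality_dep => k;
  rewrite /vadd addrA. Qed.
Lemma vaddC : commutative vadd.
Proof. by move=> x y; apply: functional_extensionality_dep => k;
  rewrite /vadd addrC. Qed.
Lemma vadd0 : left_id vzero vadd.
Proof. by move=> x; apply: functional_extensionality_dep => k;
  rewrite /vadd add0r. Qed.
Lemma vaddN : left_inverse vzero vopp vadd.
Proof. by move=> x; apply: functional_extensionality_dep => k;
  rewrite /vadd addNr. Qed.

HB.instance Definition _ :=
  GRing.isZmodule.Build (vilenkin m) vaddA vaddC vadd0 vaddN.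
HB.instance Definition _ := isPointed.Build (vilenkin m) vzero.

(* Generators of the product sigma-algebra.  Since the index set is countable
   and the factors are finite discrete, it is also the Borel sigma-algebra of
   the product topology. *)
Definition coord_sets : set (set (vilenkin m)) :=
  [set B | exists k (A : {set 'Z_(m k)}), B = [set x : vilenkin m | x k \in A]].

HB.instance Definition _ := @isMeasurable.Build (sigma_display coord_sets)
  (vilenkin m) <<s coord_sets >> (@sigma_algebra0 _ setT coord_sets)
  (@sigma_algebraC (vilenkin m) coord_sets)
  (@sigma_algebra_bigcup _ setT coord_sets).
End group.

Definition Mseq (m : nat -> nat) (k : nat) : nat := (\prod_(j < k) m j)%N.

Definition digit (m : nat -> nat) (n j : nat) : nat :=
  ((n %/ Mseq m j) %% m j)%N.

Lemma MseqS m k : Mseq m k.+1 = (m k * Mseq m k)%N.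
Proof. by rewrite /Mseq big_ord_recr /= mulnC. Qed.

Lemma ltn_Mseq m n : (forall k, (2 <= m k)%N) -> (n < Mseq m n)%N.
Proof.
move=> hm; elim: n => [|n IH]; first by rewrite /Mseq big_ord0.
rewrite MseqS (leq_trans _ (leq_mul (hm n) IH)) //.
by rewrite mul2n -addnn addnS ltnS leq_addr.
Qed.

Lemma digit_lt m n j : (forall k, (2 <= m k)%N) -> (digit m n j < m j)%N.
Proof. by move=> hm; rewrite ltn_mod (leq_trans _ (hm j)). Qed.

Lemma digit_ge m n j : (forall k, (2 <= m k)%N) -> (n <= j)%N ->
  digit m n j = 0%N.
Proof.
by move=> hm nj; rewrite /digit divn_small ?mod0n // (leq_ltn_trans nj) ?ltn_Mseq.
Qed.

Lemma digit_sum m n : (forall k, (2 <= m k)%N) ->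
  n = (\sum_(j < n) digit m n j * Mseq m j)%N.
Proof.
move=> hm.
suff H k : n = (n %/ Mseq m k * Mseq m k + \sum_(j < k) digit m n j * Mseq m j)%N.
  by rewrite [LHS](H n) divn_small ?ltn_Mseq // mul0n.
elim: k => [|k {1}->]; first by rewrite /Mseq !big_ord0 divn1 muln1 addn0.
rewrite big_ord_recr /= addnCA addnC; congr addn.
rewrite MseqS [(m k * _)%N]mulnC divnMA [(Mseq m k * _)%N]mulnC mulnA /digit.
by rewrite {1}(divn_eq (n %/ Mseq m k) (m k)) mulnDl.
Qed.

Section analysis.
Variables (R : realType) (m : nat -> nat).
Implicit Types (x t : vilenkin m) (f g : vilenkin m -> R[i]).

Definition msup : R := sup (range (fun k => (m k)%:R : R)).

(* [mu] is the product of the uniform measures on the factors; the rectangles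
   form a pi-system generating the sigma-algebra, so this determines [mu]. *)
Definition is_haar (mu : probability (vilenkin m) R) : Prop :=
  forall (n : nat) (A : forall k, {set 'Z_(m k)}),
    mu [set x : vilenkin m | forall k, (k < n)%N -> x k \in A k] =
    (\prod_(k < n) (#|A k|%:R / (m k)%:R))%:E.

Definition rademacher (k : nat) x : R[i] :=
  let theta := 2 * pi * (x k : nat)%:R / (m k)%:R in cos theta +i* sin theta.

(* By [digit_ge], the factors with index [k >= n] of the infinite product
   are all equal to 1. *)
Definition vpsi (n : nat) x : R[i] :=
  \prod_(k < n) rademacher k x ^+ digit m n k.

Variable mu : probability (vilenkin m) R.

Definition cintegral f : R[i] :=
  (\int[mu]_x complex.Re (f x)) +i* (\int[mu]_x complex.Im (f x)).

Definition Lpnorm (p : R) f : \bar R :=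
  Lnorm mu p%:E (fun x => (Normc.normc (f x))%:E).

Definition in_Lp (p : R) f : Prop :=
  [/\ measurable_fun setT (fun x => complex.Re (f x)),
      measurable_fun setT (fun x => complex.Im (f x)) &
      (Lpnorm p f < +oo)%E].

Definition fourier f (k : nat) : R[i] :=
  cintegral (fun x => f x * conjc (vpsi k x)).

Definition partial_sum (n : nat) f : vilenkin m -> R[i] :=
  fun x => \sum_(k < n) fourier f k * vpsi k x.

Definition vabs t : \bar R :=
  (\sum_(0 <= k <oo) ((t k : nat)%:R / (Mseq m k.+1)%:R)%:E)%E.

Definition modulus (p delta : R) f : \bar R :=
  ereal_sup [set Lpnorm p (fun x => f (x + t) - f x) |
             t in [set t | (vabs t < delta%:E)%E]].

End analysis.

Section norlund.
Variable R : realType.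
Implicit Types q u : nat -> R.

Definition Qsum q (n : nat) : R := \sum_(k < n) q k.

Definition norlund_fun (m : nat -> nat) (mu : probability (vilenkin m) R) q
    (n : nat) (f : vilenkin m -> R[i]) : vilenkin m -> R[i] :=
  fun x => ((Qsum q n)^-1)%:C *
    \sum_(1 <= k < n.+1) (q (n - k)%N)%:C * partial_sum mu k f x.

Definition norlund_seq q u (n : nat) : R :=
  (Qsum q n)^-1 * \sum_(1 <= k < n.+1) q (n - k)%N * u k.

(* Regularity of a summability method: it sums every convergent sequence to
   its limit.  [norlund_regularP] is the usual criterion. *)
Definition norlund_regular q : Prop :=
  forall u (l : R), u @ \oo --> l -> norlund_seq q u @ \oo --> l.

Lemma Qsum_gt0 q n : (forall k, 0 <= q k) -> 0 < q 0%N -> 0 < Qsum q n.+1.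
Proof.
move=> q0 qp; rewrite /Qsum big_ord_recl /= ltr_wpDr //.
by apply: sumr_ge0 => i _.
Qed.

Lemma Qsum_rev q n : \sum_(1 <= k < n.+1) q (n - k)%N = Qsum q n.
Proof.
rewrite big_add1 /= big_mkord /Qsum (reindex_inj rev_ord_inj) /=.
by apply: eq_bigr => i _; rewrite subnSK // subKn // ltnW.
Qed.

Lemma Qsum_le q i j : (forall k, 0 <= q k) -> (i <= j)%N ->
  Qsum q i <= Qsum q j.
Proof.
move=> q0 ij; rewrite /Qsum -!(big_mkord xpredT) (big_cat_nat (leq0n i) ij) /=.
by rewrite lerDl sumr_ge0.
Qed.

Lemma norlund_regularP q : (forall k, 0 <= q k) -> 0 < q 0%N ->
  norlund_regular q <-> (fun n => q n / Qsum q n.+1) @ \oo --> (0 : R).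
Proof.
move=> q0 qp; split=> [reg|qQ u l ul].
  pose u k : R := (k == 1%N)%:R.
  have u0 : u @ \oo --> (0 : R).
    apply/cvgrPdist_le => e e0; exists 2%N => // n /= n2.
    by rewrite /u sub0r normrN gtn_eqF // normr0 ltW.
  have := reg u 0 u0; rewrite -cvg_shiftS; apply: cvg_trans.
  apply: near_eq_cvg; near=> n.
  rewrite /= /norlund_seq big_nat_recl //= subSS subn0 /u eqxx mulr1 mulrC.
  rewrite big1_seq ?addr0 // => k /=; rewrite mem_index_iota => /andP[k1 _].
  by rewrite eqSS gtn_eqF ?mulr0.
have Q0 n : 0 < Qsum q n.+1 by exact: Qsum_gt0.
have w0 i n : 0 <= q i / Qsum q n.+1 by rewrite divr_ge0 // ltW.
have qk k : (fun n => q (n - k.+1)%N / Qsum q n) @ \oo --> (0 : R).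
  rewrite -(cvg_shiftn k.+1).
  apply: (@squeeze_cvgr _ _ _ _ (fun=> 0) (fun n => q n / Qsum q n.+1)) => //;
    last exact: cvg_cst.
  apply: nearW => n /=; rewrite addnK addnS; apply/andP; split.
    by rewrite divr_ge0 ?q0 // ltW.
  by rewrite ler_wpM2l ?q0 // lef_pV2 ?posrE ?Q0 // Qsum_le // ltnS leq_addr.
have sk K : (fun n => \sum_(1 <= k < K.+1)
    q (n - k)%N / Qsum q n * `|u k - l|) @ \oo --> (0 : R).
  elim: K => [|K IH].
    by under eq_fun do rewrite big_geq //; exact: cvg_cst.
  under eq_fun do rewrite big_nat_recr //=.
  have -> : nbhs (0 : R) = nbhs (0 + 0 * `|u K.+1 - l| : R).
    by rewrite mul0r addr0.
  by apply: cvgD; [exact: IH | apply: cvgMl; exact: qk].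
apply/cvgrPdist_le => e e0.
have e20 : 0 < e / 2 by rewrite divr_gt0.
have /cvgrPdist_le/(_ _ e20)[K _ HK] := ul.
have /cvgr0Pnorm_le/(_ _ e20)[K' _ HK'] := sk K.
exists (maxn K.+1 K') => // -[|n] /=; first by rewrite geq_max.
rewrite geq_max => /andP[Kn K'n].
have Qn := Q0 n; have Qn' := lt0r_neq0 Qn.
have -> : l - norlund_seq q u n.+1 =
    \sum_(1 <= k < n.+2) q (n.+1 - k)%N / Qsum q n.+1 * (l - u k).
  apply: (mulfI Qn'); rewrite mulrBr /norlund_seq mulVKf // -{1}Qsum_rev.
  rewrite mulr_suml -sumrB mulr_sumr; apply: eq_bigr => k _.
  by rewrite -mulrBr mulrA mulrCA divff // mulr1.
apply: (le_trans (ler_norm_sum _ _ _)).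
have Kn2 : (K.+1 <= n.+2)%N by exact: leqW.
rewrite (big_cat_nat (ltn0Sn K) Kn2) /= [leRHS](splitr e) lerD //.
  apply: le_trans (HK' n.+1 K'n); rewrite /= ger0_norm; last first.
    by apply: sumr_ge0 => k _; rewrite mulr_ge0.
  apply: ler_sum => k _.
  by rewrite normrM distrC ger0_norm.
apply: (@le_trans _ _ (\sum_(K.+1 <= k < n.+2)
    q (n.+1 - k)%N / Qsum q n.+1 * (e / 2))).
  rewrite big_seq [leRHS]big_seq; apply: ler_sum => k.
  rewrite mem_index_iota => /andP[Kk _].
  rewrite normrM ger0_norm // ler_wpM2l //.
  by apply: HK; exact: ltnW.
rewrite -mulr_suml -mulr_suml (ler_piMl (ltW e20)) // ler_pdivrMr // mul1r.
rewrite -Qsum_rev [leRHS](big_cat_nat (ltn0Sn K) Kn2) /=.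
by rewrite lerDr sumr_ge0.
Unshelve. all: by end_near. Qed.

End norlund.

(* Main.v *)
(* Let [S_k] be the partial sums, [D_k] the Dirichlet kernels, [E_i = S_(M_i)]
   and [omega_i = omega_p (1 / M_i, f)].  Since [D_(M_i)] is [M_i] times the
   indicator of the subgroup of all [t] with [t_0 = ... = t_(i-1) = 0],
   Minkowski's integral inequality gives [|| f - E_i f || <= omega_i].  Split
   [Q_n (t_n f - f)], the sum of the [q_(n-k) (S_k f - f)], along the blocks
   [M_i <= k < M_(i+1)].  On such a block
   [S_k f - f = S_k g - g] with [g = f - E_i f], and [S_k g = 0] for
   [k <= M_i], so the weights at [k <= M_i] may be replaced by [q_(n-M_i)]
   without changing the sum of the [q_(n-k) S_k g].  The new weights are
   nonincreasing in [k]; by Abel summation the resulting kernel has [L^1] norm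
   at most [q_(n-M_i)] times the largest norm of the sums
   [F_j = D_1 + ... + D_j] with [j < M_(i+1)].  Finally [|| F_j || <= 3 B^2 M_i]
   for these [j], where [B = sup m_k]: peel off the leading digit of [j], and
   for [j = M_(s+1)] use that restricting [F_(M_s)] to [x_s = 0] divides its
   norm by [m_s]. *)
From HB Require Import structures.
Require Import Defs.
From mathcomp Require Import all_boot all_order all_algebra.
From mathcomp Require Import all_classical all_reals all_analysis.
From mathcomp Require Import measurable_realfun ring lra zify.
From mathcomp.real_closed Require Import complex.

Import Order.TTheory GRing.Theory Num.Theory numFieldNormedType.Exports.
Import Normc.

Local Open Scope classical_set_scope.
Local Open Scope ring_scope.

Set Implicit Arguments.
Unset Strict Implicit.
Unset Printing Implicit Defensive.

(** * Minkowski's integral inequality *)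

(** Let [a_s] be the [L^1] norm of [F_(M_s)]. In [F_(M_(s+1))] the kernel [F_(M_s)] is multiplied by
    the sum of [r_s ^ i] over [i < m_s]. The triangle inequality would give
    [a_(s+1) <= m_s a_s + O(M_s)], which only yields [a_s = O(s M_s)], a logarithm too much. The
    complete geometric sum is [m_s] times an indicator, so [a_s] comes back with factor 1. For
    general [j] the sum is incomplete, but it only meets the already bounded [F_(M_s)], while the
    lower remainder of [j] keeps factor 1.

    The modulus is a supremum over the open ball of radius [1 / M_i], but the subgroup carrying
    [D_(M_i)] has a point of absolute value exactly [1 / M_i]. Hence Minkowski's inequality is
    stated with an almost everywhere bound.

    Constants: a digit level costs [3/2 B^2 M_s], and [M_(s+1) >= 2 M_s] makes all lower levels cost
    no more than that again, whence [3 B^2]. Blocks below the last use [3 B^2 + B <= 3 B^3], the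
    last one [3 B^2 + 1 <= 2 B^3]; both follow from [B >= 2]. *)

Lemma young_powR (R : realType) (p s a : R) : 1 <= p -> 0 <= s -> 0 <= a ->
  p * a `^ (p - 1) * s <= s `^ p + (p - 1) * a `^ p.
Proof.
move=> p1 s0 a0; move: p1; rewrite le_eqVlt => /predU1P[<-|p1].
  by rewrite subrr mul0r addr0 powRr0 !mul1r powRr1.
have p0 : 0 < p by rewrite (lt_trans ltr01).
have q0 : 0 < p - 1 by rewrite subr_gt0.
(* Young's inequality for [s] and the power [p - 1] of [a], with conjugate exponents [p] and
   [p / (p - 1)]: the convex power function lies above its tangent at [a]. The case [p = 1], where
   the conjugate exponent degenerates, is already settled. *)
have := @conjugate_powR R s (a `^ (p - 1)) p (p / (p - 1)) s0 (powR_ge0 _ _) p0.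
rewrite divr_gt0// invf_div => /(_ isT).
have -> : p^-1 + (p - 1) / p = 1 by field; rewrite gt_eqF.
move=> /(_ erefl); rewrite -powRrM.
have -> : (p - 1) * (p / (p - 1)) = p by field; rewrite gt_eqF.
rewrite -(ler_pM2l p0) mulrDr [p * (s `^ p / p)]mulrCA divff ?gt_eqF// mulr1.
have -> : p * (a `^ p * ((p - 1) / p)) = (p - 1) * a `^ p.
  by field; rewrite gt_eqF.
by rewrite -mulrA [_ * s]mulrC.
Qed.

Lemma le_poweR (R : realType) (r : R) (x y : \bar R) :
  0 <= r -> (0 <= x)%E -> (x <= y)%E -> (x `^ r <= y `^ r)%E.
Proof.
move=> r0 x0 xy; apply: gt0_ler_poweR => //; rewrite in_itv/= leey andbT//.
exact: le_trans xy.
Qed.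

Section jensen.
Local Open Scope ereal_scope.
Context d (T : measurableType d) (R : realType).
Variable mu : {measure set T -> \bar R}.

Lemma measurable_powR_comp (v : T -> R) p : measurable_fun setT v ->
  measurable_fun setT (fun x => v x `^ p)%R.
Proof. exact: (@measurableT_comp _ _ _ _ _ _ (@powR R ^~ p)). Qed.

(* Integrate the tangent inequality of [s `^ p] at the mean of [v]. *)
Lemma weighted_jensen (v w : T -> R) (p W : R) :
  measurable_fun setT v -> (forall y, (0 <= v y)%R) ->
  measurable_fun setT w -> (forall y, (0 <= w y)%R) ->
  (1 <= p)%R -> (0 < W)%R -> \int[mu]_y (w y)%:E <= W%:E ->
  (\int[mu]_y (v y * w y)%:E) `^ p <=
  (W `^ (p - 1))%:E * \int[mu]_y (v y `^ p * w y)%:E.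
Proof.
move=> mv v0 mw w0 p1 W0 wW.
have p0 : (0 < p)%R by rewrite (lt_le_trans ltr01).
have q0 : (0 <= p - 1)%R by rewrite subr_ge0.
set X := \int[mu]_y (v y `^ p * w y)%:E.
have X0 : 0 <= X.
  by apply: integral_ge0 => y _; rewrite lee_fin mulr_ge0 ?powR_ge0.
have mX : measurable_fun setT (fun y => (v y `^ p * w y)%:E).
  by apply/measurable_EFinP/measurable_funM => //; exact: measurable_powR_comp.
have mA : measurable_fun setT (fun y => (v y * w y)%:E).
  by apply/measurable_EFinP/measurable_funM.
set A := \int[mu]_y (v y * w y)%:E.
have A0 : 0 <= A by apply: integral_ge0 => y _; rewrite lee_fin mulr_ge0.
have key (a : R) : (0 <= a)%R ->
    (p * a `^ (p - 1))%:E * A <= X + ((p - 1) * a `^ p)%:E * W%:E.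
  move=> a0.
  have c0 : (0 <= p * a `^ (p - 1))%R by rewrite mulr_ge0 ?powR_ge0 ?ltW.
  have e0 : (0 <= (p - 1) * a `^ p)%R by rewrite mulr_ge0 ?powR_ge0.
  apply: (@le_trans _ _ (X + ((p - 1) * a `^ p)%:E * \int[mu]_y (w y)%:E)).
    have mEw : measurable_fun setT (fun y => (w y)%:E) by exact/measurable_EFinP.
    have wE0 y : 0 <= (w y)%:E by rewrite lee_fin.
    have vw0 y : 0 <= (v y * w y)%:E by rewrite lee_fin mulr_ge0.
    have vpw0 y : 0 <= (v y `^ p * w y)%:E.
      by rewrite lee_fin mulr_ge0 ?powR_ge0.
    rewrite -!ge0_integralZl_EFin// -ge0_integralD//; last 2 first.
    - by move=> y _; rewrite mule_ge0 ?lee_fin.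
    - exact: emeasurable_funM.
    apply: ge0_le_integral => //.
    - by move=> y _; rewrite mule_ge0 ?vw0 ?lee_fin.
    - exact: emeasurable_funM.
    - by apply: emeasurable_funD => //; exact: emeasurable_funM.
    - move=> y _; rewrite -!EFinM -EFinD lee_fin mulrA -mulrDl ler_wpM2r//.
      exact: young_powR.
  by rewrite leeD2l// lee_wpmul2l ?lee_fin.
have W1 : (0 < W `^ (p - 1))%R by rewrite powR_gt0.
(* If [A] is infinite, the tangent at 1 already forces [X] to be infinite. *)
case: A A0 key => [A| |]//; rewrite ?lee_fin => A0 key; last first.
  have := key 1%R ler01; rewrite !powR1 !mulr1 gt0_muley ?lte_fin// leye_eq.
  case: X {X0 mX key} => [X| |]//= _; rewrite gt0_muley ?lte_fin// leey//.
(* At [b = A / W] the last term of [key] is [p - 1] times [b ^ (p - 1) * A], so subtraction leaves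
   [b ^ (p - 1) * A <= X]. *)
have := key (A / W)%R (divr_ge0 A0 (ltW W0)).
case: X X0 {mX key} => [X| |]//= X0; last first.
  by move=> _; rewrite gt0_muley ?lte_fin// leey.
rewrite -!EFinM -EFinD !lee_fin => H.
set b := (A / W)%R in H.
have b0 : (0 <= b)%R by rewrite divr_ge0// ltW.
have AE : A = (b * W)%R by rewrite /b divfK// gt_eqF.
have bX : (b `^ (p - 1) * A <= X)%R.
  move: H; rewrite -(mulr_powRB1 b0 p0) AE; set c := (b `^ _)%R.
  by rewrite -lerBlDr; congr (_ <= _)%R; ring.
rewrite -(mulr_powRB1 A0 p0) {2}AE powRM ?(ltW W0)//.
by rewrite mulrA [(A * _)%R]mulrC [leRHS]mulrC ler_wpM2r ?powR_ge0.
Qed.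
End jensen.

Section integral_minkowski.
Local Open Scope ereal_scope.
Context d1 d2 (X : measurableType d1) (Y : measurableType d2) (R : realType).
Variables (mu : {sigma_finite_measure set X -> \bar R})
          (nu : {sigma_finite_measure set Y -> \bar R}).

(** For each [x], Jensen's inequality in [y] bounds the power of [h x]; Tonelli then exchanges the
    integrals, and each inner norm is at most [c]. In the applications [h] is the modulus of a
    convolution, [w] that of the kernel and [u] that of a translate or of a difference with one. The
    bound on [u] is asked only almost everywhere on the support of [w]. *)
Lemma integral_minkowski (h : X -> R) (u : X * Y -> R) (w : Y -> R)
    (p W c : R) :
  (1 <= p)%R -> (0 < W)%R -> (0 <= c)%R ->
  measurable_fun setT h -> (forall x, (0 <= h x)%R) ->
  measurable_fun setT u -> (forall z, (0 <= u z)%R) ->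
  measurable_fun setT w -> (forall y, (0 <= w y)%R) ->
  \int[nu]_y (w y)%:E <= W%:E ->
  (forall x, (h x)%:E <= \int[nu]_y (u (x, y) * w y)%:E) ->
  (\forall y \ae nu, w y != 0%R ->
     Lnorm mu p%:E (fun x => (u (x, y))%:E) <= c%:E) ->
  Lnorm mu p%:E (fun x => (h x)%:E) <= (c * W)%:E.
Proof.
move=> p1 W0 c0 mh h0 mu_ u0 mw w0 wW hu uc.
have p0 : (0 < p)%R by rewrite (lt_le_trans ltr01).
have pV0 : (0 <= p^-1)%R by rewrite invr_ge0 ltW.
have powc (I : \bar R) (a : R) : 0 <= I -> (0 <= a)%R ->
    (I `^ p^-1 <= a%:E) = (I <= (a `^ p)%:E).
  move=> I0 a0; apply/idP/idP => [H|H].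
    have := le_poweR (ltW p0) (poweR_ge0 _ _) H.
    by rewrite -poweRrM mulVf ?gt_eqF// poweRe1// poweR_EFin.
  have := le_poweR pV0 I0 H.
  by rewrite -poweR_EFin -poweRrM mulfV ?gt_eqF// poweRe1 ?lee_fin.
have normE d (Z : measurableType d) (m : {measure set Z -> \bar R}) (g : Z -> R) :
    (forall z, (0 <= g z)%R) ->
    Lnorm m p%:E (fun z => (g z)%:E) = (\int[m]_z (g z `^ p)%:E) `^ p^-1.
  move=> g0; rewrite unlock; apply: (congr1 (fun I => I `^ p^-1)).
  apply: eq_integral => z _ /=.
  by rewrite ger0_norm.
have cW0 : (0 <= c * W)%R by rewrite mulr_ge0// ltW.
rewrite normE// powc//; last first.
  by apply: integral_ge0 => x _; rewrite lee_fin powR_ge0.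
have mup : measurable_fun setT (fun z : X * Y => (u z `^ p * w z.2)%:E).
  apply/measurable_EFinP/measurable_funM; first exact: measurable_powR_comp.
  exact: measurableT_comp.
have up0 z : 0 <= (u z `^ p * w z.2)%:E by rewrite lee_fin mulr_ge0 ?powR_ge0.
have mux x : measurable_fun setT (fun y => u (x, y)).
  exact: measurableT_comp.
have muy y : measurable_fun setT (fun x => u (x, y)).
  exact: measurableT_comp.
have mF : measurable_fun setT (fun x => \int[nu]_y (u (x, y) `^ p * w y)%:E).
  exact: (measurable_fun_fubini_tonelli_F _ mup up0).
have mG : measurable_fun setT (fun y => \int[mu]_x (u (x, y) `^ p * w y)%:E).
  exact: (measurable_fun_fubini_tonelli_G _ mup up0).
apply: (@le_trans _ _ (\int[mu]_x ((W `^ (p - 1))%:E *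
    \int[nu]_y (u (x, y) `^ p * w y)%:E))).
  apply: ge0_le_integral => //.
  - by move=> x _; rewrite lee_fin powR_ge0.
  - by apply/measurable_EFinP; exact: measurable_powR_comp.
  - by apply: emeasurable_funM.
  - move=> x _; apply: le_trans (weighted_jensen _ _ _ _ p1 W0 wW) => //.
    by rewrite -poweR_EFin; apply: le_poweR => //; [exact: ltW|rewrite lee_fin].
rewrite ge0_integralZl_EFin ?powR_ge0//; last first.
  by move=> x _; apply: integral_ge0 => y _; exact: (up0 (x, y)).
rewrite (fubini_tonelli _ mup up0)/=.
have -> : ((c * W) `^ p)%:E = (W `^ (p - 1))%:E * ((c `^ p)%:E * W%:E).
  rewrite -!EFinM powRM// ?ltW// -(mulr_powRB1 (ltW W0) p0); congr EFin; ring.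
rewrite lee_pmul2l ?lte_fin ?powR_gt0//.
apply: (@le_trans _ _ (\int[nu]_y ((c `^ p)%:E * (w y)%:E))); last first.
  rewrite ge0_integralZl_EFin ?powR_ge0//; last 2 first.
  - by move=> y _; rewrite lee_fin.
  - exact/measurable_EFinP.
  by apply: lee_wpmul2l => //; rewrite lee_fin powR_ge0.
apply: ae_ge0_le_integral => //.
- by move=> y _; apply: integral_ge0 => x _; exact: (up0 (x, y)).
- by move=> y _; rewrite mule_ge0 ?lee_fin ?powR_ge0.
- by apply: emeasurable_funM => //; exact/measurable_EFinP.
apply: filterS uc => y uyc _.
have [->|wy0] := eqVneq (w y) 0%R.
  rewrite mule0; under eq_integral do rewrite mulr0.
  by rewrite integral0.
under eq_integral do rewrite EFinM.
rewrite ge0_integralZr//; last 3 first.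
- by apply/measurable_EFinP; exact: measurable_powR_comp.
- by move=> x _; rewrite lee_fin powR_ge0.
- by rewrite lee_fin.
apply: lee_wpmul2r; first by rewrite lee_fin.
rewrite -powc//; last by apply: integral_ge0 => x _; rewrite lee_fin powR_ge0.
by rewrite -normE//; exact: uyc.
Qed.
End integral_minkowski.

(** * Translation invariance of the Haar measure *)

Section measurable_group.
Variable m : nat -> nat.

Lemma measurable_coord k (A : {set 'Z_(m k)}) :
  measurable [set x : vilenkin m | x k \in A].
Proof. by apply: sub_sigma_algebra; exists k, A. Qed.

Lemma measurable_fun_vilenkin d (T : measurableType d) (f : T -> vilenkin m) :
  (forall k (A : {set 'Z_(m k)}), measurable [set t | f t k \in A]) ->
  measurable_fun setT f.
Proof.
move=> mf; apply: (@measurability _ _ _ _ _ _ (coord_sets (m := m))) => //.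
by move=> _ [_ [k [A ->]] <-]; rewrite setTI; exact: mf.
Qed.

Lemma measurable_coord_comp d (T : measurableType d) (f : T -> vilenkin m) k
    (A : {set 'Z_(m k)}) :
  measurable_fun setT f -> measurable [set t | f t k \in A].
Proof.
move=> mf; have := mf measurableT _ (measurable_coord A).
by rewrite setTI.
Qed.

(** Splitting by the finitely many values of a coordinate of the first summand turns the preimage
    into a finite union of measurable rectangles. *)
Lemma measurable_vadd :
  measurable_fun setT (fun z : vilenkin m * vilenkin m => z.1 + z.2).
Proof.
apply: measurable_fun_vilenkin => k A.
have -> : [set z : vilenkin m * vilenkin m | (z.1 + z.2) k \in A] =
    \bigcup_(a in [set: 'Z_(m k)])
      ([set z | z.1 k \in [set a]%SET] `&`
       [set z | z.2 k \in [set b | (a + b)%R \in A]%SET]).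
  apply/seteqP; split => [z zA|z [a _ [/= ]]].
    by exists (z.1 k) => //; split => /=; rewrite inE.
  by rewrite !inE => /eqP <-.
apply: fin_bigcup_measurable; first exact: finite_finset.
move=> a _; apply: measurableI; exact: measurable_coord_comp.
Qed.

Definition rectangle n (A : forall k, {set 'Z_(m k)}) : set (vilenkin m) :=
  [set x | forall k, (k < n)%N -> x k \in A k].

Definition rectangles : set (set (vilenkin m)) :=
  [set B | exists n A, B = rectangle n A].

Lemma measurable_rectangle n A : measurable (rectangle n A).
Proof.
have -> : rectangle n A =
    \bigcap_(k in [set k | (k < n)%N]) [set x | x k \in A k].
  by apply/seteqP; split.
by apply: bigcap_measurableType => k _; exact: measurable_coord.
Qed.

Lemma rectangles_setI : setI_closed rectangles.
Proof.
move=> _ _ [n [A ->]] [n' [A' ->]].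
exists (maxn n n'), (fun k => (if (k < n)%N then A k else [set: _]) :&:
                             (if (k < n')%N then A' k else [set: _]))%SET.
apply/seteqP; split => [x [xA xA'] k _|x xAA'].
  by rewrite inE; case: ifPn => [/xA ->|_]; case: ifPn => [/xA' ->|_];
    rewrite ?inE.
split=> k kn; have := xAA' k; rewrite leq_max kn ?orbT => /(_ isT);
  by rewrite inE => /andP[].
Qed.

Lemma measurable_rectanglesE :
  @measurable _ (vilenkin m) = <<s rectangles >>.
Proof.
apply/seteqP; split => B.
  apply: smallest_sub => {B}; first exact: smallest_sigma_algebra.
  move=> _ [k [A ->]]; apply: sub_sigma_algebra.
  (* A family over all [j] is needed, but [A] has type [{set 'Z_(m k)}]. Comparing underlying
     naturals replaces a cast: the set is [A] at [j = k] and everything elsewhere. *)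
  exists k.+1, (fun j => [set a | [forall b : 'Z_(m k),
    (val b == val a) && (j == k) ==> (b \in A)]])%SET.
  apply/seteqP; split => x /=.
    move=> xA j _; rewrite inE; apply/forallP => b; apply/implyP => /andP[+ /eqP jk].
    by rewrite -{}jk in A b xA * => /eqP/val_inj ->.
  by move=> /(_ k (ltnSn k)); rewrite inE => /forallP/(_ (x k)); rewrite !eqxx.
apply: smallest_sub => {B}; first exact: sigma_algebra_measurable.
by move=> _ [n [A ->]]; exact: measurable_rectangle.
Qed.

End measurable_group.

Section haar.
Variables (R : realType) (m : nat -> nat).
Variable mu : probability (vilenkin m) R.
Hypothesis mu_haar : is_haar mu.

Lemma measurable_translate (t : vilenkin m) :
  measurable_fun setT (fun x : vilenkin m => x + t).
Proof. exact: (measurable_fun_pair1 t (@measurable_vadd m)). Qed.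

(** The preimage of a rectangle under a translation is a rectangle with sides of the same
    cardinalities, and rectangles form a generating pi-system. *)
Lemma haar_translate (t : vilenkin m) B : measurable B ->
  mu ((fun x => x + t) @^-1` B) = mu B.
Proof.
have mt := measurable_translate t.
pose tr : {mfun vilenkin m >-> vilenkin m} := HB.pack (fun x : vilenkin m => x + t)
  (isMeasurableFun.Build _ _ _ _ _ mt).
apply: (@measure_unique _ _ _ (@rectangles m) (fun=> setT) _ _ _ _
  (pushforward mu tr) mu) => //.
- exact: measurable_rectanglesE.
- exact: rectangles_setI.
- by move=> _; exists 0, (fun k => [set: 'Z_(m k)])%SET; apply/seteqP; split.
- by apply/seteqP; split => // x _; exists 0.
- move=> _ [n [A ->]]; change (mu (tr @^-1` rectangle n A) = mu (rectangle n A)).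
  have -> : tr @^-1` rectangle n A =
      rectangle n (fun k => [set a | (a + t k)%R \in A k]%SET).
    by apply/seteqP; split => x /= xA k kn; have := xA k kn; rewrite inE.
  rewrite [LHS]mu_haar [RHS]mu_haar; congr EFin; apply: eq_bigr => k _.
  congr (_%:R / _).
  by rewrite -(card_preimset (A k) (addIr (t k))); apply: eq_card => a; rewrite !inE.
- move=> _; change (mu (tr @^-1` setT) < +oo)%E.
  by rewrite preimage_setT probability_setT ltry.
Qed.

Lemma integral_translate (t : vilenkin m) (g : vilenkin m -> \bar R) :
  measurable_fun setT g ->
  (\int[mu]_x g (x + t)%R = \int[mu]_x g x)%E.
Proof.
move=> mg.
have mt := measurable_translate t.
have key (h : vilenkin m -> \bar R) : measurable_fun setT h ->
    (forall x, 0 <= h x)%E -> (\int[mu]_x h (x + t)%R = \int[mu]_x h x)%E.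
  move=> mh h0.
  have := ge0_integral_pushforward mt mu measurableT mh (fun x _ => h0 x).
  rewrite preimage_setT => <-.
  apply: eq_measure_integral => B mB _.
  change (mu ((fun x => x + t) @^-1` B) = mu B).
  exact: haar_translate.
rewrite integralE [RHS]integralE; congr (_ - _)%E.
  rewrite -[RHS]key//; first by apply: eq_integral => x _; rewrite !funeposE.
  by apply: measurable_funepos.
rewrite -[RHS]key//; first by apply: eq_integral => x _; rewrite !funenegE.
by apply: measurable_funeneg.
Qed.
End haar.

(** * Complex-valued functions *)

Section normc.
Local Open Scope complex_scope.
Variable R : rcfType.
Implicit Types (x y : R[i]) (a : R).

Lemma normc_ge0 x : 0 <= normc x.
Proof. by case: x => a b; exact: sqrtr_ge0. Qed.

Lemma ler_normcD x y : normc (x + y) <= normc x + normc y.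
Proof. exact: le_normcD. Qed.

Lemma normc_opp x : normc (- x) = normc x.
Proof. exact: normcN. Qed.

Lemma normc_real a : normc a%:C = `|a|.
Proof. by rewrite /= expr0n/= addr0 sqrtr_sqr. Qed.

Lemma normc_conj x : normc (conjc x) = normc x.
Proof. by case: x => a b /=; rewrite sqrrN. Qed.

Lemma normc_sum I (r : seq I) (P : pred I) (F : I -> R[i]) :
  normc (\sum_(i <- r | P i) F i) <= \sum_(i <- r | P i) normc (F i).
Proof.
elim/big_rec2: _ => [|i a x _ IH]; first by rewrite normc0.
by rewrite (le_trans (ler_normcD _ _))// lerD2l.
Qed.

Lemma ler_Re_normc x : `|complex.Re x| <= normc x.
Proof.
case: x => a b /=; rewrite -sqrtr_sqr ler_sqrt ?addr_ge0 ?sqr_ge0//.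
by rewrite lerDl sqr_ge0.
Qed.

Lemma ler_Im_normc x : `|complex.Im x| <= normc x.
Proof.
case: x => a b /=; rewrite -sqrtr_sqr ler_sqrt ?addr_ge0 ?sqr_ge0//.
by rewrite lerDr sqr_ge0.
Qed.

(** Cauchy-Schwarz in the plane, read off from the real part of [conjc x * y]. *)
Lemma ler_ReM_normc x y :
  complex.Re x * complex.Re y + complex.Im x * complex.Im y <=
  normc x * normc y.
Proof.
have := ler_Re_normc (conjc x * y); rewrite normcM normc_conj.
apply: le_trans; apply: le_trans (ler_norm _).
by case: x y => [a b] [c d] /=; rewrite mulNr opprK.
Qed.

Lemma normc_sqr x : normc x ^+ 2 = complex.Re x ^+ 2 + complex.Im x ^+ 2.
Proof. by case: x => a b /=; rewrite sqr_sqrtr// addr_ge0 ?sqr_ge0. Qed.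

End normc.

(** * Measurability of complex-valued functions *)

Section cmeasurable.
Local Open Scope complex_scope.
Context d (T : measurableType d) (R : realType).
Implicit Types f g : T -> R[i].

Definition cmeasurable f :=
  measurable_fun setT (fun x => complex.Re (f x)) /\
  measurable_fun setT (fun x => complex.Im (f x)).

Lemma cmeasurable_cst (z : R[i]) : cmeasurable (fun=> z).
Proof. by split; exact: measurable_cst. Qed.

Lemma cmeasurableD f g :
  cmeasurable f -> cmeasurable g -> cmeasurable (fun x => f x + g x).
Proof.
move=> [f1 f2] [g1 g2]; split.
  by under eq_fun do rewrite raddfD; exact: measurable_funD.
by under eq_fun do rewrite raddfD; exact: measurable_funD.
Qed.

Lemma cmeasurableM f g :
  cmeasurable f -> cmeasurable g -> cmeasurable (fun x => f x * g x).
Proof.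
move=> [f1 f2] [g1 g2]; split.
  rewrite (_ : (fun x => _) = (fun x => complex.Re (f x) * complex.Re (g x) -
      complex.Im (f x) * complex.Im (g x))).
    by apply: measurable_funB; exact: measurable_funM.
  by apply/funext => x; case: (f x) => a b; case: (g x).
rewrite (_ : (fun x => _) = (fun x => complex.Re (f x) * complex.Im (g x) +
    complex.Im (f x) * complex.Re (g x))).
  by apply: measurable_funD; exact: measurable_funM.
by apply/funext => x; case: (f x) => a b; case: (g x).
Qed.

Lemma cmeasurableB f g :
  cmeasurable f -> cmeasurable g -> cmeasurable (fun x => f x - g x).
Proof.
move=> mf mg; under eq_fun do rewrite -mulN1r.
by apply: cmeasurableD => //; apply: cmeasurableM => //; exact: cmeasurable_cst.
Qed.

Lemma cmeasurable_sum I (r : seq I) (P : pred I) (F : I -> T -> R[i]) :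
  (forall i, cmeasurable (F i)) ->
  cmeasurable (fun x => \sum_(i <- r | P i) F i x).
Proof.
move=> mF; elim: r => [|i r IH].
  by under eq_fun do rewrite big_nil; exact: cmeasurable_cst.
under eq_fun do rewrite big_cons.
by case: (P i) => //; exact: cmeasurableD.
Qed.

Lemma cmeasurable_prod I (r : seq I) (P : pred I) (F : I -> T -> R[i]) :
  (forall i, cmeasurable (F i)) ->
  cmeasurable (fun x => \prod_(i <- r | P i) F i x).
Proof.
move=> mF; elim: r => [|i r IH].
  by under eq_fun do rewrite big_nil; exact: cmeasurable_cst.
under eq_fun do rewrite big_cons.
by case: (P i) => //; exact: cmeasurableM.
Qed.

Lemma cmeasurableX f n : cmeasurable f -> cmeasurable (fun x => f x ^+ n).
Proof.
move=> mf; elim: n => [|n IH]; first exact: cmeasurable_cst.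
by under eq_fun do rewrite exprS; exact: cmeasurableM.
Qed.

Lemma cmeasurable_conj f : cmeasurable f -> cmeasurable (fun x => conjc (f x)).
Proof.
move=> [f1 f2]; split.
  by rewrite (_ : (fun x => _) = (fun x => complex.Re (f x)))//;
    apply/funext => x; case: (f x).
rewrite (_ : (fun x => _) = (fun x => - complex.Im (f x))).
  exact: measurable_funN.
by apply/funext => x; case: (f x).
Qed.

Lemma measurable_normc f :
  cmeasurable f -> measurable_fun setT (fun x => normc (f x)).
Proof.
move=> [f1 f2]; rewrite (_ : (fun x => _) =
    (fun x => (complex.Re (f x) ^+ 2 + complex.Im (f x) ^+ 2) `^ 2^-1)).
  apply: measurable_powR_comp; apply: measurable_funD; exact: measurable_funX.
apply/funext => x; case: (f x) => a b /=.
by rewrite powR12_sqrt// addr_ge0 ?sqr_ge0.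
Qed.

End cmeasurable.

Lemma cmeasurable_comp d d' (T : measurableType d) (T' : measurableType d')
    (R : realType) (f : T -> R[i]) (h : T' -> T) :
  measurable_fun setT h -> cmeasurable f -> cmeasurable (fun x => f (h x)).
Proof.
by move=> mh [f1 f2]; split; [exact: (measurableT_comp f1)|
  exact: (measurableT_comp f2)].
Qed.

(** * Integration of complex-valued functions *)

Section cintegral.
Local Open Scope complex_scope.
Variables (R : realType) (m : nat -> nat) (mu : probability (vilenkin m) R).
Implicit Types f g : vilenkin m -> R[i].

Definition cintegrable f :=
  cmeasurable f /\ (\int[mu]_x (normc (f x))%:E < +oo)%E.

Lemma cintegrable_Re f : cintegrable f ->
  mu.-integrable setT (EFin \o (fun x => complex.Re (f x))).
Proof.
move=> [mf intf]; apply/integrableP; split.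
  by apply/measurable_EFinP; case: mf.
apply: le_lt_trans intf; apply: ge0_le_integral => //.
- by apply/measurable_EFinP/measurableT_comp => //; case: mf.
- by apply/measurable_EFinP; exact: measurable_normc.
- by move=> x _ /=; rewrite lee_fin ler_Re_normc.
Qed.

Lemma cintegrable_Im f : cintegrable f ->
  mu.-integrable setT (EFin \o (fun x => complex.Im (f x))).
Proof.
move=> [mf intf]; apply/integrableP; split.
  by apply/measurable_EFinP; case: mf.
apply: le_lt_trans intf; apply: ge0_le_integral => //.
- by apply/measurable_EFinP/measurableT_comp => //; case: mf.
- by apply/measurable_EFinP; exact: measurable_normc.
- by move=> x _ /=; rewrite lee_fin ler_Im_normc.
Qed.

Lemma cintegrableD f g : cintegrable f -> cintegrable g ->
  cintegrable (fun x => f x + g x).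
Proof.
move=> [mf fi] [mg gi]; split; first exact: cmeasurableD.
have mnf := measurable_normc mf; have mng := measurable_normc mg.
apply: (@le_lt_trans _ _ (\int[mu]_x (normc (f x))%:E +
                          \int[mu]_x (normc (g x))%:E)%E); last first.
  exact: lte_add_pinfty.
rewrite -ge0_integralD//.
- apply: ge0_le_integral => //.
  + by move=> x _; rewrite lee_fin normc_ge0.
  + by apply/measurable_EFinP/measurable_normc; exact: cmeasurableD.
  + by apply: emeasurable_funD; exact/measurable_EFinP.
  + by move=> x _; rewrite -EFinD lee_fin ler_normcD.
- by move=> x _; rewrite lee_fin normc_ge0.
- exact/measurable_EFinP.
- by move=> x _; rewrite lee_fin normc_ge0.
- exact/measurable_EFinP.
Qed.

Lemma cintegrableM_bounded f g (C : R) : cintegrable f -> cmeasurable g ->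
  (forall x, normc (g x) <= C) -> cintegrable (fun x => f x * g x).
Proof.
move=> [mf fi] mg gC; split; first exact: cmeasurableM.
have C0 : 0 <= C by rewrite (le_trans (normc_ge0 (g 0))).
apply: (@le_lt_trans _ _ (C%:E * \int[mu]_x (normc (f x))%:E)%E); last first.
  by rewrite lte_mul_pinfty.
rewrite -ge0_integralZl_EFin//; last 2 first.
- by move=> x _; rewrite lee_fin normc_ge0.
- by apply/measurable_EFinP; exact: measurable_normc.
apply: ge0_le_integral => //.
- by move=> x _; rewrite lee_fin normc_ge0.
- by apply/measurable_EFinP/measurable_normc; exact: cmeasurableM.
- apply: emeasurable_funM => //.
  by apply/measurable_EFinP; exact: measurable_normc.
- move=> x _; rewrite -EFinM lee_fin normcM mulrC ler_wpM2r//.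
  exact: normc_ge0.
Qed.

Lemma cintegrableZ a f : cintegrable f -> cintegrable (fun x => a * f x).
Proof.
move=> fi; under eq_fun do rewrite mulrC.
by apply: (cintegrableM_bounded (C := normc a)) => //; exact: cmeasurable_cst.
Qed.

Lemma cintegrable0 : cintegrable (fun=> 0).
Proof.
split; first exact: cmeasurable_cst.
by under eq_integral do rewrite normc0; rewrite integral0 ltry.
Qed.

Lemma cintegrable1 : cintegrable (fun=> 1).
Proof.
split; first exact: cmeasurable_cst.
under eq_integral do rewrite normc1.
by rewrite integral_cst// mul1e (le_lt_trans (probability_le1 mu measurableT))// ltry.
Qed.

Lemma cintegrable_bounded g (C : R) : cmeasurable g ->
  (forall x, normc (g x) <= C) -> cintegrable g.
Proof.
move=> mg gC; have := cintegrableM_bounded cintegrable1 mg gC.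
by under eq_fun do rewrite mul1r.
Qed.

Lemma cintegrable_sum I (r : seq I) (P : pred I) (F : I -> vilenkin m -> R[i]) :
  (forall i, cintegrable (F i)) ->
  cintegrable (fun x => \sum_(i <- r | P i) F i x).
Proof.
move=> mF; elim: r => [|i r IH].
  by under eq_fun do rewrite big_nil; exact: cintegrable0.
under eq_fun do rewrite big_cons.
by case: (P i) => //; exact: cintegrableD.
Qed.

Lemma cintegralD f g : cintegrable f -> cintegrable g ->
  cintegral mu (fun x => f x + g x) = cintegral mu f + cintegral mu g.
Proof.
move=> fi gi; rewrite /cintegral.
under [X in X +i* _]eq_Rintegral do rewrite raddfD.
under [X in _ +i* X]eq_Rintegral do rewrite raddfD.
rewrite !RintegralD//;
  solve [exact: cintegrable_Re | exact: cintegrable_Im].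
Qed.

Lemma cintegralZ a f : cintegrable f ->
  cintegral mu (fun x => a * f x) = a * cintegral mu f.
Proof.
move=> fi; rewrite /cintegral.
have iR := cintegrable_Re fi; have iI := cintegrable_Im fi.
case: a => a b.
have -> : \int[mu]_x complex.Re ((a +i* b) * f x) =
    \int[mu]_x (a * complex.Re (f x) + (- b) * complex.Im (f x)).
  by apply: eq_Rintegral => x _; case: (f x) => c e /=; rewrite mulNr.
have -> : \int[mu]_x complex.Im ((a +i* b) * f x) =
    \int[mu]_x (a * complex.Im (f x) + b * complex.Re (f x)).
  by apply: eq_Rintegral => x _; case: (f x) => c e /=.
have iZ c h : mu.-integrable setT (EFin \o h) ->
    mu.-integrable setT (EFin \o (fun x => c * h x)).
  by move=> ih; exact: (integrableZl measurableT c ih).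
rewrite !RintegralD//; try exact: iZ.
by rewrite !RintegralZl// mulNr.
Qed.

Lemma cintegral0 : cintegral mu (fun=> 0) = 0.
Proof. by rewrite /cintegral !Rintegral_cst// !mul0r. Qed.

Lemma cintegral1 : cintegral mu (fun=> 1) = 1.
Proof.
rewrite /cintegral !Rintegral_cst//= mul0r mul1r.
by rewrite [X in fine X](probability_setT mu).
Qed.

Lemma cintegral_sum I (r : seq I) (P : pred I) (F : I -> vilenkin m -> R[i]) :
  (forall i, cintegrable (F i)) ->
  cintegral mu (fun x => \sum_(i <- r | P i) F i x) =
  \sum_(i <- r | P i) cintegral mu (F i).
Proof.
move=> mF; elim: r => [|i r IH].
  by rewrite big_nil; under eq_fun do rewrite big_nil; exact: cintegral0.
under eq_fun do rewrite big_cons.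
rewrite big_cons; case: ifP => // _.
by rewrite cintegralD ?IH//; exact: cintegrable_sum.
Qed.

(** With [z] the integral, the square of [normc z] is the integral of [Re z * Re f + Im z * Im f],
    which is pointwise at most [normc z * normc f]. One factor [normc z] is then cancelled, so
    [z = 0] is treated apart. *)
Lemma normc_cintegral f : cintegrable f ->
  ((normc (cintegral mu f))%:E <= \int[mu]_x (normc (f x))%:E)%E.
Proof.
move=> fi; have [mf _] := fi; set z := cintegral mu f.
have iR := cintegrable_Re fi; have iI := cintegrable_Im fi.
have [z0|z0] := eqVneq (normc z) 0.
  by rewrite z0; apply: integral_ge0 => x _; rewrite lee_fin normc_ge0.
have zp : 0 < normc z by rewrite lt_neqAle eq_sym z0 normc_ge0.
have iN : mu.-integrable setT (EFin \o (fun x => normc (f x))).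
  apply/integrableP; split.
    by apply/measurable_EFinP; exact: measurable_normc.
  case: fi => _; apply: le_lt_trans; rewrite le_eqVlt; apply/orP; left.
  by apply/eqP/eq_integral => x _ /=; rewrite ger0_norm ?normc_ge0.
have -> : (\int[mu]_x (normc (f x))%:E = (\int[mu]_x normc (f x))%:E)%E.
  by rewrite /Rintegral fineK//; exact: integrable_fin_num.
rewrite lee_fin -(ler_pM2l zp) -expr2 normc_sqr !expr2.
have iZ c h : mu.-integrable setT (EFin \o h) ->
    mu.-integrable setT (EFin \o (fun x => c * h x)).
  by move=> ih; exact: (integrableZl measurableT c ih).
(* Only one factor of each square becomes an integral; the other stays as a constant to be moved
   inside. *)
rewrite {2 4}/z /cintegral/= -!RintegralZl// -RintegralD//; [|exact: iZ..].
apply: le_Rintegral => //.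
- exact: (integrableD measurableT (iZ _ _ iR) (iZ _ _ iI)).
- exact: iZ.
- by move=> x _; exact: (ler_ReM_normc (cintegral mu f) (f x)).
Qed.

Lemma cintegral_translate (mu_haar : is_haar mu) t f : cmeasurable f ->
  cintegral mu (fun x => f (x + t)) = cintegral mu f.
Proof.
move=> [f1 f2]; congr (_ +i* _); congr fine.
  by rewrite (integral_translate mu_haar t (g := fun x => (complex.Re (f x))%:E))//;
    exact/measurable_EFinP.
by rewrite (integral_translate mu_haar t (g := fun x => (complex.Im (f x))%:E))//;
  exact/measurable_EFinP.
Qed.

End cintegral.

(** * Characters *)

Section cexp.
Local Open Scope complex_scope.
Variable R : realType.
Implicit Types a b : R.

Definition cexp a : R[i] := cos a +i* sin a.

Lemma cexp0 : cexp 0 = 1.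
Proof. by rewrite /cexp cos0 sin0. Qed.

Lemma cexpD a b : cexp (a + b) = cexp a * cexp b.
Proof. by rewrite /cexp cosD sinD /GRing.mul/= [sin a * _ + _]addrC. Qed.

Lemma cexpMn a n : cexp (a *+ n) = cexp a ^+ n.
Proof.
by elim: n => [|n IH]; rewrite ?mulr0n ?cexp0// mulrS exprS cexpD IH.
Qed.

Lemma normc_cexp a : normc (cexp a) = 1.
Proof. by rewrite /= cos2Dsin2 sqrtr1. Qed.

Lemma cexp_2pi : cexp (2 * pi) = 1.
Proof. by rewrite mulr2n mulrDl mul1r /cexp cos2pi sin2pi. Qed.

(** By the half-angle formula [cos a = 1] forces [sin (a / 2) = 0], while [a / 2] lies strictly
    between 0 and [pi]. *)
Lemma cexp_neq1 a : 0 < a < 2 * pi -> cexp a != 1.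
Proof.
move=> /andP[a0 a2]; apply/eqP => -[cosa _].
have s0 : 0 < sin (a / 2).
  by rewrite sin_gt0_pi// divr_gt0//= ltr_pdivrMr// mulrC.
have : cos (a / 2 *+ 2) = 1 by rewrite -mulr_natr divfK.
rewrite cos_mulr2n cos2sin2 => H.
have : sin (a / 2) ^+ 2 = 0 by lra.
by apply/eqP; rewrite gt_eqF// exprn_gt0.
Qed.

End cexp.

Section characters.
Local Open Scope complex_scope.
Variables (R : realType) (m : nat -> nat).
Hypothesis m_ge2 : forall k, (2 <= m k)%N.
Implicit Types x y t : vilenkin m.

Local Notation r := (@rademacher R m).
Local Notation psi := (@vpsi R m).
Local Notation M := (Mseq m).

Definition zeta k : R[i] := cexp (2 * pi / (m k)%:R).

Lemma m_gt0 k : (0 < m k)%N. Proof. by rewrite (leq_trans _ (m_ge2 k)). Qed.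

Lemma Mseq_gt0 k : (0 < M k)%N.
Proof. by apply: prodn_gt0 => i; exact: m_gt0. Qed.

Lemma Zp_ltn k (a : 'Z_(m k)) : (a < m k)%N.
Proof. by rewrite -[X in (_ < X)%N](Zp_cast (m_ge2 k)) ltn_ord. Qed.

Lemma zetaX_m k : zeta k ^+ m k = 1.
Proof.
by rewrite -cexpMn -[_ *+ m k]mulr_natr divfK ?cexp_2pi// pnatr_eq0 -lt0n m_gt0.
Qed.

Lemma rademacherE k x : r k x = zeta k ^+ (x k).
Proof. by rewrite -cexpMn -[_ *+ x k]mulr_natr mulrAC. Qed.

Lemma zetaX_neq1 k a : (0 < a < m k)%N -> zeta k ^+ a != 1.
Proof.
move=> /andP[a0 am]; rewrite -cexpMn; apply: cexp_neq1.
have p0 := pi_gt0 R.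
have m0 : 0 < (m k)%:R :> R by rewrite ltr0n m_gt0.
rewrite pmulrn_lgt0// divr_gt0 ?mulr_gt0//= -[_ *+ a]mulr_natr mulrAC.
by rewrite ltr_pdivrMr// ltr_pM2l ?mulr_gt0// ltr_nat.
Qed.

Lemma rademacherD k x y : r k (x + y) = r k x * r k y.
Proof.
rewrite !rademacherE -exprD -(expr_mod (x k + y k) (zetaX_m k)).
by congr (_ ^+ _); apply: congr2 (Zp_cast (m_ge2 k)).
Qed.

Lemma rademacher0 k : r k 0 = 1.
Proof. by rewrite rademacherE. Qed.

Lemma normc_rademacher k x : normc (r k x) = 1.
Proof. exact: normc_cexp. Qed.

Lemma rademacherX_m k x : r k x ^+ m k = 1.
Proof. by rewrite rademacherE -exprM mulnC exprM zetaX_m expr1n. Qed.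

Lemma rademacher_neq1 k x : x k != 0 -> r k x != 1.
Proof.
by move=> xk; rewrite rademacherE zetaX_neq1// Zp_ltn andbT lt0n.
Qed.

Lemma rademacher_eq0 k x : x k = 0 -> r k x = 1.
Proof. by move=> xk; rewrite rademacherE xk. Qed.

(** A geometric sum: off [x k = 0] its ratio is an [m k]-th root of unity other than 1. *)
Lemma sum_rademacher k x :
  \sum_(c < m k) r k x ^+ c = (m k * (x k == 0))%:R :> R[i].
Proof.
have [/rademacher_eq0 ->|/rademacher_neq1 H] := eqVneq (x k) 0.
  under eq_bigr do rewrite expr1n.
  by rewrite sumr_const card_ord muln1.
rewrite muln0; apply/eqP; rewrite -subr_eq0 in H.
have /eqP := subrX1 (r k x) (m k).
by rewrite rademacherX_m subrr eq_sym mulf_eq0 (negPf H).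
Qed.

(** In this form it shows that adding a multiple of [M s] does not change the digit at any
    [k < s]. *)
Lemma Mseq_dvd k s : (k < s)%N -> exists u, M s = (u * m k * M k)%N.
Proof.
elim: s => // s IH; rewrite ltnS leq_eqVlt => /predU1P[->|/IH[u Mu]].
  by exists 1%N; rewrite MseqS mul1n.
by exists (m s * u)%N; rewrite MseqS Mu !mulnA.
Qed.

Lemma leq_Mseq i j : (i <= j)%N -> (M i <= M j)%N.
Proof.
elim: j => [|j IH]; first by rewrite leqn0 => /eqP ->.
rewrite leq_eqVlt => /predU1P[->//|/IH H].
by rewrite MseqS (leq_trans H)// leq_pmull// m_gt0.
Qed.

Lemma digit_big n K k : (n < M K)%N -> (K <= k)%N -> digit m n k = 0%N.
Proof.
by move=> nK Kk; rewrite /digit divn_small ?mod0n// (leq_trans nK)// leq_Mseq.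
Qed.

(** The definition of [psi n] takes [n] factors; here the length follows the number of digits, so
    that characters can be compared digit by digit. Both products are padded with ones to a common
    length. *)
Lemma vpsiE K n x : (n < M K)%N -> psi n x = \prod_(k < K) r k x ^+ digit m n k.
Proof.
move=> nK; have H J : (n < M J)%N -> \prod_(k < J) r k x ^+ digit m n k =
    \prod_(k < maxn J (maxn K n)) r k x ^+ digit m n k.
  move=> nJ; rewrite -!(big_mkord xpredT (fun k => r k x ^+ digit m n k)).
  rewrite [RHS](big_cat_nat (leq0n J) (leq_maxl _ _))/= [X in _ = _ * X]big1_seq.
    by rewrite mulr1.
  move=> k; rewrite mem_index_iota => /andP[_ /andP[Jk _]].
  by rewrite (digit_big nJ).
rewrite /vpsi (H n) ?ltn_Mseq// [RHS]H//.
by have -> : maxn n (maxn K n) = maxn K (maxn K n) by lia.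
Qed.

Lemma vpsiD n x y : psi n (x + y) = psi n x * psi n y.
Proof.
rewrite /vpsi -big_split; apply: eq_bigr => k _.
by rewrite rademacherD exprMn.
Qed.

Lemma vpsi_0 n : psi n 0 = 1.
Proof. by rewrite /vpsi big1// => k _; rewrite rademacher0 expr1n. Qed.

Lemma vpsi0 x : psi 0 x = 1.
Proof. by rewrite /vpsi big_ord0. Qed.

Lemma normc_vpsi n x : normc (psi n x) = 1.
Proof.
rewrite /vpsi; elim/big_ind: _ => [|a b ha hb|k _]; first exact: normc1.
  by rewrite normcM ha hb mulr1.
elim: (digit m n k) => [|d IH]; first exact: normc1.
by rewrite exprS normcM IH normc_rademacher mulr1.
Qed.

Lemma conjc_unit (z : R[i]) : normc z = 1 -> conjc z = z^-1.
Proof.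
case: z => a b /= H.
have : a ^+ 2 + b ^+ 2 = 1.
  by rewrite -[LHS]sqr_sqrtr ?H ?expr1n// addr_ge0 ?sqr_ge0.
by move=> {}H; rewrite /GRing.inv/= H !divr1.
Qed.

Lemma conjc_vpsi n x : conjc (psi n x) = psi n (- x).
Proof.
have H : psi n x * psi n (- x) = 1 by rewrite -vpsiD subrr vpsi_0.
have nz : psi n x != 0.
  by apply/eqP => H0; move/eqP: H; rewrite H0 mul0r eq_sym oner_eq0.
by rewrite conjc_unit ?normc_vpsi//; apply: (mulfI nz); rewrite H divff.
Qed.

(** Source of all the recursions below: [c] becomes the digit at [s], and the digits of [b] are
    untouched. *)
Lemma vpsi_block s c b x : (c < m s)%N -> (b < M s)%N ->
  psi (c * M s + b) x = r s x ^+ c * psi b x.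
Proof.
move=> cm bM.
have M0 := Mseq_gt0.
have lt : (c * M s + b < M s.+1)%N.
  rewrite MseqS (@leq_trans (c.+1 * M s))//.
    by rewrite mulSn addnC ltn_add2r.
  by rewrite leq_mul2r cm orbT.
rewrite (vpsiE _ lt) (vpsiE _ bM) big_ord_recr/= mulrC; congr (_ * _).
  by congr (_ ^+ _); rewrite /digit divnMDl// (divn_small bM) addn0 modn_small.
apply: eq_bigr => -[k /= ks] _; congr (_ ^+ _); rewrite /digit.
have [u ->] := Mseq_dvd ks.
by rewrite !mulnA divnMDl// modnMDl.
Qed.

Lemma cmeasurable_coord_fun k (h : 'Z_(m k) -> R[i]) :
  cmeasurable (fun x : vilenkin m => h (x k)).
Proof.
have H (g : 'Z_(m k) -> R) : measurable_fun setT (fun x : vilenkin m => g (x k)).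
  move=> _ B _; rewrite setTI.
  rewrite (_ : _ @^-1` B = [set x : vilenkin m | x k \in [set a | `[< B (g a) >]]%SET]).
    exact: measurable_coord.
  by apply/seteqP; split => x /=; rewrite inE asboolE.
by split; [exact: (H (fun a => complex.Re (h a)))|
  exact: (H (fun a => complex.Im (h a)))].
Qed.

Lemma cmeasurable_vpsi n : cmeasurable (psi n).
Proof.
apply: (@cmeasurable_prod _ _ _ _ _ _
  (fun (k : 'I_n) x => r k x ^+ digit m n k)) => k.
apply: cmeasurableX.
exact: (cmeasurable_coord_fun (fun a => cexp (2 * pi * a%:R / (m k)%:R))).
Qed.

Lemma digit_inj l k : (forall j, digit m l j = digit m k j) -> l = k.
Proof.
have H n K : (n <= K)%N -> n = (\sum_(j < K) digit m n j * M j)%N.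
  move=> nK; rewrite {1}(digit_sum n m_ge2).
  rewrite -!(big_mkord xpredT (fun j => (digit m n j * M j)%N)).
  rewrite [RHS](big_cat_nat (leq0n n) nK)/= [X in (_ + X)%N]big1_seq ?addn0//.
  move=> j; rewrite mem_index_iota => /andP[_ /andP[nj _]].
  by rewrite digit_ge.
move=> E; rewrite (H l (maxn l k)) ?leq_maxl// [RHS](H k (maxn l k)) ?leq_maxr//.
by apply: eq_bigr => j _; rewrite E.
Qed.

Definition basis_vec s : vilenkin m := fun k => (k == s)%:R.

(** A basis vector isolates one digit of [n], which is how two different characters are told
    apart. *)
Lemma vpsi_basis_vec n s : psi n (basis_vec s) = zeta s ^+ digit m n s.
Proof.
rewrite (@vpsiE (maxn n s.+1)); last first.
  by rewrite (leq_trans (ltn_Mseq n m_ge2))// leq_Mseq// leq_maxl.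
have ss : (s < maxn n s.+1)%N by rewrite leq_max ltnSn orbT.
rewrite (bigD1 (Ordinal ss))//= big1 ?mulr1.
  by rewrite rademacherE /basis_vec eqxx -exprM /= modn_small// mul1n.
move=> k ks; rewrite rademacher_eq0 ?expr1n// /basis_vec.
by rewrite -(inj_eq val_inj) /= in ks; rewrite (negPf ks).
Qed.

Variable mu : probability (vilenkin m) R.
Hypothesis mu_haar : is_haar mu.

(* Translating by an element where the character [psi l / psi k] is not [1]
   shows that its integral vanishes. *)
Lemma vpsi_orthonormal l k :
  cintegral mu (fun x => psi l x * conjc (psi k x)) = (l == k)%:R.
Proof.
have [->|lk] := eqVneq l k.
  transitivity (cintegral mu (fun=> 1)); last exact: cintegral1.
  congr cintegral; apply/funext => x.
  by rewrite conjc_vpsi -vpsiD subrr vpsi_0.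
have [s ls] : exists s, digit m l s != digit m k s.
  apply: contrapT => /forallNP H; move/eqP: lk; apply; apply: digit_inj => j.
  by have /negP := H j; rewrite negbK => /eqP.
pose chi x := psi l x * conjc (psi k x).
have chiD x y : chi (x + y) = chi y * chi x.
  by rewrite /chi (vpsiD l) (vpsiD k) rmorphM mulrACA mulrC.
have chim : cmeasurable chi.
  apply: cmeasurableM; first exact: cmeasurable_vpsi.
  by apply: cmeasurable_conj; exact: cmeasurable_vpsi.
have chii : cintegrable mu chi.
  apply: (@cintegrable_bounded _ _ _ _ 1) => // x.
  by rewrite normcM normc_conj !normc_vpsi mulr1.
have /eqP : chi (basis_vec s) * cintegral mu chi = cintegral mu chi.
  apply: etrans (cintegral_translate mu_haar (basis_vec s) chim).
  apply: etrans (esym (cintegralZ _ chii)) _.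
  by apply: (congr1 (cintegral mu)); apply/funext => x; exact/esym/chiD.
rewrite -subr_eq0 -{2}[cintegral mu chi]mul1r -mulrBl.
rewrite mulf_eq0 => /orP[|/eqP//].
rewrite subr_eq0 /chi conjc_unit ?normc_vpsi// !vpsi_basis_vec => /eqP H.
have zn0 a : zeta s ^+ a != 0.
  rewrite expf_neq0//; apply/eqP => z0; have : normc (zeta s) = 1 by exact: normc_cexp.
  by rewrite z0 normc0 => /eqP; rewrite eq_sym oner_eq0.
have {}H : zeta s ^+ digit m l s = zeta s ^+ digit m k s.
  by rewrite -[LHS](divfK (zn0 (digit m k s))) H mul1r.
have key a b : (a < b)%N -> (b < m s)%N -> zeta s ^+ a <> zeta s ^+ b.
  move=> ab bm E; have /eqP[] : zeta s ^+ (b - a) != 1.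
    by rewrite zetaX_neq1// subn_gt0 ab (leq_ltn_trans (leq_subr _ _)).
  by apply: (mulIf (zn0 a)); rewrite -exprD (subnK (ltnW ab)) mul1r.
have lm := digit_lt l s m_ge2; have km := digit_lt k s m_ge2.
exfalso; move: ls; rewrite neq_ltn => /orP[ab|ab].
  exact: (key _ _ ab km H).
exact: (key _ _ ab lm (esym H)).
Qed.

End characters.

(** * Dirichlet kernels and their sums *)

Section kernels.
Local Open Scope complex_scope.
Variables (R : realType) (m : nat -> nat).
Hypothesis m_ge2 : forall k, (2 <= m k)%N.
Implicit Types x y t : vilenkin m.

Local Notation r := (@rademacher R m).
Local Notation psi := (@vpsi R m).
Local Notation M := (Mseq m).

Definition dirichlet k x : R[i] := \sum_(l < k) psi l x.

(* [j] times the Fejer kernel *)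
Definition fejer j x : R[i] := \sum_(k < j) dirichlet k.+1 x.

Lemma vpsi_tail s l t : (l < M s)%N -> (forall k, (k < s)%N -> t k = 0) ->
  psi l t = 1.
Proof.
move=> ls t0; rewrite (vpsiE _ m_ge2 _ ls) big1// => k _.
by rewrite rademacher_eq0 ?expr1n ?t0.
Qed.

Lemma dirichletD s c b x : (c < m s)%N -> (b <= M s)%N ->
  dirichlet (c * M s + b) x = dirichlet (c * M s) x + r s x ^+ c * dirichlet b x.
Proof.
move=> cm bM; rewrite /dirichlet big_split_ord/= mulr_sumr; congr (_ + _).
by apply: eq_bigr => l _; rewrite vpsi_block// (leq_trans (ltn_ord l)).
Qed.

Lemma dirichletM s c x : (c <= m s)%N ->
  dirichlet (c * M s) x = (\sum_(i < c) r s x ^+ i) * dirichlet (M s) x.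
Proof.
elim: c => [|c IH] cm; first by rewrite /dirichlet mul0n !big_ord0 mul0r.
by rewrite mulSn addnC dirichletD// big_ord_recr/= mulrDl IH// ltnW.
Qed.

(** Going from [s] to [s.+1] multiplies by the full geometric sum of [r s], that is, by [m s] times
    the indicator of [x s = 0]. *)
Lemma dirichlet_Mseq s x :
  dirichlet (M s) x = (M s * [forall k : 'I_s, x k == 0])%:R.
Proof.
elim: s => [|s IH].
  rewrite /dirichlet /Mseq big_ord0 big_ord1 vpsi0.
  by case: forallP => // -[] [].
rewrite MseqS dirichletM// sum_rademacher// IH -natrM; congr (_%:R).
rewrite mulnACA; congr (_ * _)%N; rewrite mulnb; congr nat_of_bool.
apply/andP/forallP => [[/eqP xs /forallP H] [k /= ks]|H].
  move: (ks); rewrite ltnS leq_eqVlt => /predU1P[->|ks']; first by rewrite xs.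
  exact: (H (Ordinal ks')).
split; first exact: (H ord_max).
by apply/forallP => k; exact: (H (widen_ord (leqnSn s) k)).
Qed.

(** Each of the last [b] kernels splits, by [dirichletD], into the fixed [dirichlet (c * M s)] and a
    rotated kernel of lower index. *)
Lemma fejerD s c b x : (c < m s)%N -> (b <= M s)%N ->
  fejer (c * M s + b) x =
  fejer (c * M s) x + b%:R * dirichlet (c * M s) x + r s x ^+ c * fejer b x.
Proof.
move=> cm bM; rewrite /fejer big_split_ord/= -addrA; congr (_ + _).
rewrite [r s x ^+ c * _]mulr_sumr mulr_natl -[X in _ *+ X]card_ord -sumr_const -big_split/=.
apply: eq_bigr => l _.
by rewrite -addnS dirichletD// (leq_trans (ltn_ord l)).
Qed.

Lemma fejerM s c x : (c <= m s)%N ->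
  fejer (c * M s) x = (M s)%:R * (\sum_(i < c) dirichlet (i * M s) x) +
    (\sum_(i < c) r s x ^+ i) * fejer (M s) x.
Proof.
elim: c => [|c IH] cm; first by rewrite /fejer mul0n !big_ord0 mul0r mulr0 addr0.
by rewrite mulSn addnC fejerD// !big_ord_recr/= IH ?(ltnW cm)//; ring.
Qed.

Lemma cmeasurable_dirichlet k : cmeasurable (dirichlet k).
Proof.
by apply: (@cmeasurable_sum _ _ _ _ _ _ (fun (l : 'I_k) x => psi l x)) => l;
  exact: cmeasurable_vpsi.
Qed.

Lemma cmeasurable_fejer j : cmeasurable (fejer j).
Proof.
by apply: (@cmeasurable_sum _ _ _ _ _ _ (fun (k : 'I_j) x => dirichlet k.+1 x))
  => k; exact: cmeasurable_dirichlet.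
Qed.

Lemma cmeasurable_rademacher k : cmeasurable (r k).
Proof.
exact: (cmeasurable_coord_fun (fun a => cexp (2 * pi * a%:R / (m k)%:R))).
Qed.

Lemma normc_rademacherX k x c : normc (r k x ^+ c) = 1.
Proof.
elim: c => [|c IH]; first exact: normc1.
by rewrite exprS normcM IH normc_rademacher mulr1.
Qed.

Variable mu : probability (vilenkin m) R.
Hypothesis mu_haar : is_haar mu.

Definition L1norm (W : vilenkin m -> R[i]) : \bar R :=
  (\int[mu]_x (normc (W x))%:E)%E.

Lemma L1normD (f g : vilenkin m -> R[i]) (a b : R) :
  cmeasurable f -> cmeasurable g ->
  (L1norm f <= a%:E)%E -> (L1norm g <= b%:E)%E ->
  (L1norm (fun x => (f x + g x)%R) <= (a + b)%:E)%E.
Proof.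
move=> mf mg fa gb; rewrite EFinD; apply: le_trans (leeD fa gb).
have mnf := measurable_normc mf; have mng := measurable_normc mg.
rewrite /L1norm -ge0_integralD//.
- apply: ge0_le_integral => //.
  + by move=> x _; rewrite lee_fin normc_ge0.
  + by apply/measurable_EFinP/measurable_normc; exact: cmeasurableD.
  + by apply: emeasurable_funD; exact/measurable_EFinP.
  + by move=> x _; rewrite -EFinD lee_fin ler_normcD.
- by move=> x _; rewrite lee_fin normc_ge0.
- exact/measurable_EFinP.
- by move=> x _; rewrite lee_fin normc_ge0.
- exact/measurable_EFinP.
Qed.

Lemma L1norm0 : L1norm (fun=> 0) = 0%E.
Proof. by rewrite /L1norm normc0 integral0. Qed.

Lemma L1norm_sum n (F : nat -> vilenkin m -> R[i]) (a : nat -> R) :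
  (forall i, cmeasurable (F i)) ->
  (forall i, (i < n)%N -> (L1norm (F i) <= (a i)%:E)%E) ->
  (L1norm (fun x => (\sum_(i < n) F i x)%R) <= (\sum_(i < n) a i)%:E)%E.
Proof.
move=> mF; elim: n => [|n IH] Fa.
  rewrite big_ord0 (_ : (fun x => _) = fun=> 0) ?L1norm0//.
  by apply/funext => x; rewrite big_ord0.
rewrite big_ord_recr/= (_ : (fun x => _) =
    (fun x => (\sum_(i < n) F i x + F n x)%R)); last first.
  by apply/funext => x; rewrite big_ord_recr.
apply: L1normD => //; last exact: Fa.
  by apply: (@cmeasurable_sum _ _ _ _ _ _ (fun (i : 'I_n) x => F i x)).
by apply: IH => i ni; apply: Fa; rewrite ltnW.
Qed.

Lemma L1normZ (z : R[i]) (f : vilenkin m -> R[i]) (a : R) :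
  cmeasurable f -> (L1norm f <= a%:E)%E ->
  (L1norm (fun x => (z * f x)%R) <= (normc z * a)%:E)%E.
Proof.
move=> mf fa; rewrite /L1norm; under eq_integral do rewrite normcM EFinM.
rewrite ge0_integralZl_EFin ?normc_ge0//.
- by rewrite EFinM; apply: lee_wpmul2l; rewrite ?lee_fin ?normc_ge0.
- by move=> x _; rewrite lee_fin normc_ge0.
- by apply/measurable_EFinP; exact: measurable_normc.
Qed.

Lemma L1norm_rademacher s c (f : vilenkin m -> R[i]) :
  L1norm (fun x => r s x ^+ c * f x) = L1norm f.
Proof.
by apply: eq_integral => x _; rewrite normcM normc_rademacherX mul1r.
Qed.

Lemma L1norm_dirichlet_Mseq s : L1norm (dirichlet (M s)) = 1%E.
Proof.
pose A : forall k, {set 'Z_(m k)} := fun k => [set 0]%SET.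
have M0 : (M s)%:R != 0 :> R by rewrite pnatr_eq0 -lt0n Mseq_gt0.
have -> : L1norm (dirichlet (M s)) =
    (\int[mu]_x ((M s)%:R%:E * (\1_(rectangle s A) x)%:E))%E.
  apply: eq_integral => x _; rewrite dirichlet_Mseq -EFinM; congr EFin.
  have -> : ((M s * [forall k : 'I_s, x k == 0])%:R : R[i]) =
      ((M s * [forall k : 'I_s, x k == 0])%:R : R)%:C by rewrite rmorph_nat.
  rewrite normc_real ger0_norm// natrM indicE; congr (_ * (nat_of_bool _)%:R).
  apply/forallP/idP => [H|].
    by rewrite inE => k ks; rewrite inE; exact: (H (Ordinal ks)).
  by rewrite inE => H k; have := H k (ltn_ord k); rewrite inE.
rewrite ge0_integralZl_EFin//.
- rewrite integral_indic ?setIT//; last exact: measurable_rectangle.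
  rewrite [X in (_ * X)%E](mu_haar s A) -EFinM; congr EFin; rewrite /Mseq natr_prod -big_split/=.
  by apply: big1 => k _; rewrite cards1 mul1r divff// pnatr_eq0 -lt0n m_gt0.
- by apply/measurable_EFinP/measurable_indic; exact: measurable_rectangle.
Qed.

Lemma L1norm_dirichletM s c : (c <= m s)%N ->
  (L1norm (dirichlet (c * M s)) <= c%:R%:E)%E.
Proof.
move=> cm; rewrite (_ : dirichlet _ =
  fun x => \sum_(i < c) r s x ^+ i * dirichlet (M s) x); last first.
  by apply/funext => x; rewrite dirichletM// mulr_suml.
have -> : (c%:R : R) = \sum_(i < c) 1 by rewrite sumr_const card_ord.
apply: (@L1norm_sum c (fun i x => r s x ^+ i * dirichlet (M s) x) (fun=> 1)).
  move=> i; apply: cmeasurableM; last exact: cmeasurable_dirichlet.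
  by apply: cmeasurableX; exact: cmeasurable_rademacher.
by move=> i _; rewrite L1norm_rademacher L1norm_dirichlet_Mseq.
Qed.

Lemma basis_vecMn s c k : (basis_vec m s *+ c) k = ((k == s) * c)%:R.
Proof.
elim: c => [|c IH]; first by rewrite mulr0n muln0.
by rewrite mulrS mulnS natrD -IH.
Qed.

Lemma basis_vec_shift s x (c : 'Z_(m s)) : (x + basis_vec m s *+ c) s = x s + c.
Proof. by congr (_ + _); rewrite basis_vecMn eqxx mul1n natr_Zp. Qed.

(* Average over the translates by the multiples of the basis vector [s]. *)
Lemma L1norm_restrict s (g : vilenkin m -> R[i]) : cmeasurable g ->
  (forall x c, g (x + basis_vec m s *+ c) = g x) ->
  L1norm (fun x => (m s * (x s == 0))%:R * g x) = L1norm g.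
Proof.
move=> mg gs.
pose h x : R := (x s == 0)%:R * normc (g x).
have mh : measurable_fun setT h.
  apply: measurable_funM; last exact: measurable_normc.
  rewrite (_ : (fun x : vilenkin m => _) = \1_[set x | x s \in [set 0]%SET]).
    by apply: measurable_indic; exact: measurable_coord.
  by apply/funext => x; rewrite indicE; congr ((nat_of_bool _)%:R);
    apply/idP/idP; rewrite ?inE/= ?inE.
have h0 x : 0 <= h x by rewrite mulr_ge0// normc_ge0.
have htr c : (\int[mu]_x (h (x + basis_vec m s *+ c)%R)%:E = \int[mu]_x (h x)%:E)%E.
  by apply: (integral_translate mu_haar _ (g := fun x => (h x)%:E)); exact/measurable_EFinP.
have -> : L1norm g = (\int[mu]_x \sum_(c : 'Z_(m s))
    (h (x + basis_vec m s *+ c)%R)%:E)%E.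
  apply: eq_integral => x _; rewrite sumEFin /h; congr EFin.
  (* Exactly one translate, [c = - x s], has coordinate [s] equal to zero. *)
  rewrite (bigD1 (- x s))// basis_vec_shift subrr eqxx gs mul1r.
  rewrite big1 => [|c /= cx]; first exact/esym/addr0.
  rewrite basis_vec_shift addrC addr_eq0.
  by rewrite (negPf cx) mul0r.
rewrite ge0_integral_sum//.
- rewrite (eq_bigr (fun=> \int[mu]_x (h x)%:E)%E) => [|c _]; last exact: htr.
  rewrite -ge0_integral_sum//; last 2 first.
  - by move=> c; exact/measurable_EFinP.
  - by move=> c x _; rewrite lee_fin.
  apply: eq_integral => x _; rewrite sumEFin; congr EFin.
  rewrite sumr_const card_ord [X in _ = _ *+ X](Zp_cast (m_ge2 s)).
  rewrite normcM -(rmorph_nat (real_complex R)) normc_real ger0_norm//.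
  by rewrite -[RHS]mulr_natl natrM mulrA.
- move=> c; apply/measurable_EFinP.
  exact: (measurableT_comp mh (measurable_translate _)).
- by move=> c x _; rewrite lee_fin.
Qed.

(** All frequencies in [fejer (M s)] are below [M s], so only the first [s] coordinates matter. This
    is the invariance that [L1norm_restrict] requires. *)
Lemma fejer_tail s x c : fejer (M s) (x + basis_vec m s *+ c) = fejer (M s) x.
Proof.
apply: eq_bigr => k _; apply: eq_bigr => l _; rewrite vpsiD//.
have -> : psi l (basis_vec m s *+ c) = 1; last by rewrite mulr1.
apply: (@vpsi_tail s); first exact: leq_trans (ltn_ord l) (ltn_ord k).
by move=> j js; rewrite basis_vecMn (ltn_eqF js) mul0n.
Qed.

Variable B : R.
Hypothesis m_leB : forall k, (m k)%:R <= B.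

Lemma bound_ge2 : 2 <= B.
Proof. by apply: le_trans (m_leB 0); rewrite (ler_nat _ 2). Qed.

Lemma sum_ord_natr n : \sum_(i < n) i%:R = n%:R * (n%:R - 1) / 2 :> R.
Proof.
elim: n => [|n IH]; first by rewrite big_ord0 mul0r mul0r.
by rewrite big_ord_recr/= IH -natr1; field.
Qed.

Lemma cmeasurable_sum_dirichlet s c :
  cmeasurable (fun x => \sum_(i < c) dirichlet (i * M s) x).
Proof.
by apply: (@cmeasurable_sum _ _ _ _ _ _ (fun (i : 'I_c) x =>
  dirichlet (i * M s) x)) => i; exact: cmeasurable_dirichlet.
Qed.

Lemma L1norm_sum_dirichlet s c : (c <= m s)%N ->
  (L1norm (fun x => (M s)%:R * \sum_(i < c) dirichlet (i * M s) x)%R <=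
   ((M s)%:R * (c%:R * (c%:R - 1) / 2))%:E)%E.
Proof.
move=> cm; rewrite -sum_ord_natr.
have -> : ((M s)%:R : R) = normc (M s)%:R.
  by rewrite -(rmorph_nat (real_complex R)) normc_real ger0_norm.
apply: L1normZ; first exact: cmeasurable_sum_dirichlet.
apply: (@L1norm_sum c (fun i => dirichlet (i * M s)) (fun i => i%:R)).
  by move=> i; exact: cmeasurable_dirichlet.
by move=> i ic; rewrite L1norm_dirichletM// (leq_trans (ltnW ic)).
Qed.

(** By [L1norm_restrict] the old norm enters the recursion with factor 1. The step closes because
    [m (m - 1) / 2 + B <= B m], that is, [(m - 1) (B - m / 2) >= 0], for [m = m s]. *)
Lemma L1norm_fejer_Mseq s : (L1norm (fejer (M s)) <= (B * (M s)%:R)%:E)%E.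
Proof.
have B2 := bound_ge2.
elim: s => [|s IH].
  rewrite (_ : fejer _ = fun=> 1).
    rewrite /L1norm normc1 integral_cst// mul1e.
    rewrite (le_trans (probability_le1 mu measurableT))// lee_fin.
    by rewrite /Mseq big_ord0; lra.
  apply/funext => x; rewrite /fejer /Mseq big_ord0 big_ord1 /dirichlet big_ord1.
  exact: vpsi0.
rewrite MseqS (_ : fejer _ = fun x =>
    (M s)%:R * (\sum_(i < m s) dirichlet (i * M s) x) +
    (m s * (x s == 0))%:R * fejer (M s) x); last first.
  by apply/funext => x; rewrite fejerM// sum_rademacher.
apply: (@le_trans _ _ ((M s)%:R * ((m s)%:R * ((m s)%:R - 1) / 2) +
    B * (M s)%:R)%:E).
  apply: L1normD.
  - apply: cmeasurableM; first exact: cmeasurable_cst.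
    exact: cmeasurable_sum_dirichlet.
  - apply: cmeasurableM; last exact: cmeasurable_fejer.
    exact: (cmeasurable_coord_fun (fun a => (m s * (a == 0))%:R)).
  - exact: L1norm_sum_dirichlet.
  - rewrite L1norm_restrict; first exact: IH.
      exact: cmeasurable_fejer.
    by move=> x c; exact: fejer_tail.
rewrite lee_fin natrM.
have m2 : 2 <= (m s)%:R :> R by rewrite (ler_nat _ 2).
have mB := m_leB s.
have Ms : 0 <= (M s)%:R :> R by rewrite ler0n.
rewrite [B * (_ * _)]mulrA [B * _ * (M s)%:R]mulrC [B * (M s)%:R]mulrC -mulrDr.
by rewrite ler_wpM2l//; nra.
Qed.

(** Write [j = c * M s + b]. In units of [M s], the multiples of [M s] cost [c (c - 1) / 2], the
    copies of [fejer (M s)] cost [B c], and the term [b * dirichlet (c * M s)] at most [c]. As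
    [c <= B - 1], the total is at most [3/2 B^2]; the remainder [b] costs [C]. *)
Lemma L1norm_fejer_block s (C : R) j :
  (forall b, (b < M s)%N -> (L1norm (fejer b) <= C%:E)%E) ->
  (j < M s.+1)%N ->
  (L1norm (fejer j) <= (3 / 2 * B ^+ 2 * (M s)%:R + C)%:E)%E.
Proof.
move=> IH; rewrite MseqS => jM; have B2 := bound_ge2.
rewrite (divn_eq j (M s)); set c := (j %/ M s)%N; set b := (j %% M s)%N.
have cm : (c < m s)%N by rewrite ltn_divLR// Mseq_gt0.
have bM : (b < M s)%N by rewrite ltn_mod Mseq_gt0.
rewrite (_ : fejer _ = fun x =>
    (M s)%:R * (\sum_(i < c) dirichlet (i * M s) x) +
    (\sum_(i < c) r s x ^+ i * fejer (M s) x) +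
    b%:R * dirichlet (c * M s) x + r s x ^+ c * fejer b x); last first.
  by apply/funext => x; rewrite fejerD// 1?ltnW// fejerM ?mulr_suml// ltnW.
apply: (@le_trans _ _ ((M s)%:R * (c%:R * (c%:R - 1) / 2) +
    \sum_(i < c) (B * (M s)%:R) + b%:R * c%:R + C)%:E).
  have mrM i j' : cmeasurable (fun x => r s x ^+ i * fejer j' x).
    apply: cmeasurableM; last exact: cmeasurable_fejer.
    by apply: cmeasurableX; exact: cmeasurable_rademacher.
  have m1 : cmeasurable (fun x =>
      (M s)%:R * (\sum_(i < c) dirichlet (i * M s) x)).
    apply: cmeasurableM; first exact: cmeasurable_cst.
    exact: cmeasurable_sum_dirichlet.
  have m2 : cmeasurable (fun x => \sum_(i < c) r s x ^+ i * fejer (M s) x).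
    exact: (@cmeasurable_sum _ _ _ _ _ _ (fun (i : 'I_c) x =>
      r s x ^+ i * fejer (M s) x)).
  have m3 : cmeasurable (fun x => b%:R * dirichlet (c * M s) x).
    apply: cmeasurableM; first exact: cmeasurable_cst.
    exact: cmeasurable_dirichlet.
  apply: L1normD => //; first by do 2 apply: cmeasurableD => //.
    apply: L1normD => //; first exact: cmeasurableD.
      apply: L1normD => //; first exact: L1norm_sum_dirichlet (ltnW cm).
      apply: (@L1norm_sum c (fun i x => r s x ^+ i * fejer (M s) x)
        (fun=> B * (M s)%:R)) => // i _.
      by rewrite L1norm_rademacher L1norm_fejer_Mseq.
    have -> : (b%:R : R) = normc b%:R.
      by rewrite -(rmorph_nat (real_complex R)) normc_real ger0_norm.
    apply: L1normZ; first exact: cmeasurable_dirichlet.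
    exact: L1norm_dirichletM (ltnW cm).
  by rewrite L1norm_rademacher; exact: IH.
rewrite lee_fin lerD2r sumr_const card_ord -[(B * _) *+ c]mulr_natr.
have c0 : 0 <= c%:R :> R by rewrite ler0n.
have cB : c%:R <= B - 1 :> R.
  by apply: le_trans (lerB (m_leB s) (lexx 1)); rewrite lerBrDr natr1 ler_nat.
have bM' : b%:R <= (M s)%:R :> R by rewrite ler_nat ltnW.
have M0 : 0 <= (M s)%:R :> R by rewrite ler0n.
have : b%:R * c%:R <= (M s)%:R * c%:R :> R by rewrite ler_wpM2r.
move: (c%:R : R) (b%:R : R) ((M s)%:R : R) c0 cB bM' M0 => x y z x0 xB yz z0 yx.
have H : x * (x - 1) / 2 + B * x + x <= 3 / 2 * B ^+ 2 by nra.
have : z * (x * (x - 1) / 2 + B * x + x) <= z * (3 / 2 * B ^+ 2).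
  by rewrite ler_wpM2l.
lra.
Qed.

(** [C = 3/2 B^2 M_s] is reproduced by the block recursion: a step doubles it, and
    [M_(s+1) >= 2 M_s] absorbs the doubling. *)
Lemma L1norm_fejer_small s j : (j < M s)%N ->
  (L1norm (fejer j) <= (3 / 2 * B ^+ 2 * (M s)%:R)%:E)%E.
Proof.
have B2 := bound_ge2.
elim: s j => [|s IH] j.
  rewrite {1}/Mseq big_ord0 ltnS leqn0 => /eqP ->.
  rewrite (_ : fejer 0 = fun=> 0) ?L1norm0 ?lee_fin.
    by rewrite mulr_ge0// mulr_ge0// sqr_ge0.
  by apply/funext => x; rewrite /fejer big_ord0.
move=> /(L1norm_fejer_block IH) /le_trans; apply; rewrite lee_fin MseqS natrM.
have m2 : 2 <= (m s)%:R :> R by rewrite (ler_nat _ 2).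
have : 0 <= 3 / 2 * B ^+ 2 * (M s)%:R by rewrite mulr_ge0// mulr_ge0// sqr_ge0.
set z := 3 / 2 * B ^+ 2 * (M s)%:R; move=> z0.
rewrite (_ : 3 / 2 * B ^+ 2 * ((m s)%:R * (M s)%:R) = (m s)%:R * z); last first.
  by rewrite /z; ring.
nra.
Qed.

Lemma L1norm_fejer s j : (j < M s.+1)%N ->
  (L1norm (fejer j) <= (3 * B ^+ 2 * (M s)%:R)%:E)%E.
Proof.
move=> /(L1norm_fejer_block (@L1norm_fejer_small s)) /le_trans; apply.
by rewrite lee_fin; lra.
Qed.

Lemma sum_dirichlet_abel (w : nat -> R) K x :
  \sum_(k < K) (w k)%:C * dirichlet k.+1 x =
  \sum_(k < K) (w k - w k.+1)%:C * fejer k.+1 x + (w K)%:C * fejer K x.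
Proof.
elim: K => [|K IH]; first by rewrite !big_ord0 /fejer big_ord0 mulr0 addr0.
rewrite !big_ord_recr/= IH rmorphB/=.
have -> : fejer K.+1 x = fejer K x + dirichlet K.+1 x.
  by rewrite /fejer big_ord_recr.
by ring.
Qed.

(** After Abel summation all coefficients are nonnegative and telescope to [w 0], so one common
    bound on the kernels is enough. *)
Lemma L1norm_sum_dirichlet_decreasing (w : nat -> R) K (C : R) :
  (forall k, 0 <= w k) -> (forall k, w k.+1 <= w k) ->
  (forall j, (j <= K)%N -> (L1norm (fejer j) <= C%:E)%E) ->
  (L1norm (fun x => \sum_(k < K) (w k)%:C * dirichlet k.+1 x)%R <=
   (w 0%N * C)%:E)%E.
Proof.
move=> w0 wd FC.
rewrite (_ : (fun x => _) = fun x =>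
    \sum_(k < K) (w k - w k.+1)%:C * fejer k.+1 x + (w K)%:C * fejer K x); last first.
  by apply/funext => x; rewrite sum_dirichlet_abel.
have -> : w 0%N * C = \sum_(k < K) (w k - w k.+1) * C + w K * C.
  rewrite -mulr_suml -mulrDl; congr (_ * _).
  elim: K {FC} => [|K IH]; first by rewrite big_ord0 add0r.
  by rewrite big_ord_recr/= IH; ring.
have mF c j : cmeasurable (fun x => c%:C * fejer j x).
  apply: cmeasurableM; first exact: cmeasurable_cst.
  exact: cmeasurable_fejer.
have cF c j : 0 <= c -> (j <= K)%N ->
    (L1norm (fun x => c%:C * fejer j x)%R <= (c * C)%:E)%E.
  move=> c0 jK; rewrite -[X in (X * C)%:E](ger0_norm c0) -normc_real.
  by apply: L1normZ; [exact: cmeasurable_fejer|exact: FC].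
apply: L1normD => //.
- exact: (@cmeasurable_sum _ _ _ _ _ _ (fun (k : 'I_K) x =>
    (w k - w k.+1)%:C * fejer k.+1 x)).
- apply: (@L1norm_sum K (fun k x => (w k - w k.+1)%:C * fejer k.+1 x)
    (fun k => (w k - w k.+1) * C)) => // k kK.
  by apply: cF => //; rewrite subr_ge0.
- exact: cF.
Qed.

End kernels.

(** * Norms, moduli of continuity and partial sums *)

Section Lp.
Local Open Scope complex_scope.
Variables (R : realType) (m : nat -> nat) (mu : probability (vilenkin m) R).
Variable p : R.
Hypothesis p_ge1 : 1 <= p.
Implicit Types f g : vilenkin m -> R[i].

Let p_gt0 : 0 < p. Proof. exact: lt_le_trans p_ge1. Qed.

Lemma LpnormE f :
  Lpnorm mu p f = ((\int[mu]_x (normc (f x) `^ p)%:E) `^ p^-1)%E.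
Proof.
rewrite /Lpnorm unlock; apply: (congr1 (fun I => I `^ p^-1)%E).
apply: eq_integral => x _ /=.
by rewrite ger0_norm ?normc_ge0.
Qed.

Lemma Lpnorm_ge0 f : (0 <= Lpnorm mu p f)%E.
Proof. exact: Lnorm_ge0. Qed.

Lemma LpnormD f g : cmeasurable f -> cmeasurable g ->
  (Lpnorm mu p (fun x => (f x + g x)%R) <= Lpnorm mu p f + Lpnorm mu p g)%E.
Proof.
move=> mf mg; have mnf := measurable_normc mf; have mng := measurable_normc mg.
apply: le_trans (minkowski_EFin mu mnf mng p_ge1).
rewrite LpnormE unlock; apply: le_poweR.
- by rewrite invr_ge0 ltW.
- by apply: integral_ge0 => x _; rewrite lee_fin powR_ge0.
apply: ge0_le_integral => //.
- by move=> x _; rewrite lee_fin powR_ge0.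
- apply/measurable_EFinP/measurable_powR_comp/measurable_normc.
  exact: cmeasurableD.
- apply/measurable_EFinP/measurable_powR_comp; apply: measurableT_comp => //.
  exact: measurable_funD.
- move=> x _ /=; rewrite lee_fin.
  apply: ge0_ler_powR; rewrite ?nnegrE ?normc_ge0//; first exact: ltW.
  by rewrite (le_trans (ler_normcD _ _))// ler_norm.
Qed.

Lemma LpnormZ (z : R[i]) f : cmeasurable f ->
  Lpnorm mu p (fun x => z * f x) = ((normc z)%:E * Lpnorm mu p f)%E.
Proof.
move=> mf; rewrite LpnormE [in RHS]LpnormE.
under eq_integral do rewrite normcM powRM ?normc_ge0// EFinM.
rewrite ge0_integralZl_EFin ?powR_ge0//; last 2 first.
- by move=> x _; rewrite lee_fin powR_ge0.
- by apply/measurable_EFinP/measurable_powR_comp; exact: measurable_normc.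
rewrite poweRM ?lee_fin ?powR_ge0//; last first.
  by apply: integral_ge0 => x _; rewrite lee_fin powR_ge0.
rewrite poweR_EFin -powRrM divff ?gt_eqF// powRr1 ?normc_ge0//.
Qed.

Lemma Lpnorm_sum n (F : nat -> vilenkin m -> R[i]) :
  (forall i, cmeasurable (F i)) ->
  (Lpnorm mu p (fun x => (\sum_(i < n) F i x)%R) <=
   \sum_(i < n) Lpnorm mu p (F i))%E.
Proof.
move=> mF; elim: n => [|n IH].
  rewrite big_ord0 LpnormE.
  under eq_integral do rewrite big_ord0 normc0 powR0 ?gt_eqF//.
  by rewrite integral0 poweR0r// invr_eq0 gt_eqF.
rewrite big_ord_recr/= (_ : (fun x => _) =
    (fun x => (\sum_(i < n) F i x + F n x)%R)); last first.
  by apply/funext => x; rewrite big_ord_recr.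
apply: le_trans (LpnormD _ _) _ => //; last exact: leeD2r.
by apply: (@cmeasurable_sum _ _ _ _ _ _ (fun (i : 'I_n) x => F i x)).
Qed.

Lemma Lpnorm_translate (mu_haar : is_haar mu) t f : cmeasurable f ->
  Lpnorm mu p (fun x => f (x + t)) = Lpnorm mu p f.
Proof.
move=> mf; rewrite LpnormE [RHS]LpnormE.
apply: (congr1 (fun I => I `^ p^-1)%E).
apply: (integral_translate mu_haar t (g := fun x => (normc (f x) `^ p)%:E)).
by apply/measurable_EFinP/measurable_powR_comp; exact: measurable_normc.
Qed.

Lemma in_Lp_cmeasurable f : in_Lp mu p f -> cmeasurable f.
Proof. by case. Qed.

(** On a probability space [normc f <= 1 + normc f ^ p] is integrable; Fourier coefficients and
    convolutions rely on this. *)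
Lemma in_Lp_cintegrable f : in_Lp mu p f -> cintegrable mu f.
Proof.
move=> fp; have mf := in_Lp_cmeasurable fp; split => //.
have mn := measurable_normc mf.
case: fp => _ _; rewrite LpnormE => /lty_poweRy.
rewrite invr_eq0 gt_eqF// => /(_ isT) H.
apply: (@le_lt_trans _ _ (\int[mu]_x 1%:E +
    \int[mu]_x (normc (f x) `^ p)%:E)%E); last first.
  apply: lte_add_pinfty => //; rewrite integral_cst// mul1e.
  by rewrite (le_lt_trans (probability_le1 mu measurableT))// ltry.
have mnp : measurable_fun setT (fun x => (normc (f x) `^ p)%:E).
  by apply/measurable_EFinP; exact: measurable_powR_comp.
rewrite -ge0_integralD//; last by move=> x _; rewrite lee_fin powR_ge0.
apply: ge0_le_integral => //.
- by move=> x _; rewrite lee_fin normc_ge0.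
- exact/measurable_EFinP.
- exact: emeasurable_funD.
- move=> x _; rewrite -EFinD lee_fin.
  have [n1|/ltW n1] := leP (normc (f x)) 1.
    by rewrite (le_trans n1)// lerDl powR_ge0.
  by rewrite (le_trans (le1r_powR n1 p_ge1))// lerDr.
Qed.

End Lp.

(** * The absolute value on the subgroups of the Vilenkin group *)

Section modulus.
Local Open Scope complex_scope.
Variables (R : realType) (m : nat -> nat).
Hypothesis m_ge2 : forall k, (2 <= m k)%N.
Local Notation M := (Mseq m).
Local Notation Mr k := ((Mseq m k)%:R : R).

Let M0 k : 0 < Mr k. Proof. by rewrite ltr0n Mseq_gt0. Qed.

(** [1 / M K] is the largest possible tail from [K] on. Since [1 / M K = m K / M K.+1] and
    [t K + 1 <= m K], the first two terms together do not increase with [K]; the non-maximal digit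
    at [k0] leaves the spare [1 / M k0.+1]. *)
Lemma vabs_partial_sum (t : vilenkin m) i k0 K :
  (forall k, (k < i)%N -> t k = 0) -> (i <= k0)%N -> ((t k0).+1 < m k0)%N ->
  (i <= K)%N ->
  \sum_(0 <= k < K) (t k)%:R / Mr k.+1 + (Mr K)^-1 + (k0 < K)%:R / Mr k0.+1
    <= (Mr i)^-1.
Proof.
move=> t0 ik0 tk0 /subnKC <-; elim: (K - i)%N => [|d IH].
  rewrite addn0 big1_seq ?add0r.
    by rewrite ltnNge ik0 mul0r addr0.
  by move=> k; rewrite mem_index_iota => /andP[_ /andP[_ /t0 ->]]; rewrite mul0r.
apply: le_trans IH; rewrite addnS; set K' := (i + d)%N.
rewrite big_nat_recr//= -!addrA lerD2l.
have MK : (Mr K')^-1 = (m K')%:R / Mr K'.+1.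
  rewrite MseqS natrM invfM mulrA divff ?mul1r// pnatr_eq0 -lt0n.
  exact: m_gt0.
have v0 : 0 <= (Mr K'.+1)^-1 by rewrite invr_ge0 ltW.
rewrite MK; have [k0K|k0K] := eqVneq k0 K'.
  rewrite -k0K in v0 *; rewrite ltnSn ltnn mul0r addr0.
  rewrite (_ : _ + _ = ((t k0).+2)%:R / Mr k0.+1); last by rewrite -!natr1; ring.
  by rewrite ler_wpM2r// ler_nat.
rewrite addrA (_ : (k0 < K'.+1)%N = (k0 < K')%N); last first.
  by rewrite ltnS leq_eqVlt (negPf k0K).
rewrite lerD2r -[X in _ + X]mul1r -mulrDl ler_wpM2r//.
by rewrite natr1 ler_nat; exact: Zp_ltn.
Qed.

(** The spare term of [vabs_partial_sum] does not depend on [K], so it survives the limit and makes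
    the inequality strict. *)
Lemma vabs_lt (t : vilenkin m) i k0 :
  (forall k, (k < i)%N -> t k = 0) -> (i <= k0)%N -> ((t k0).+1 < m k0)%N ->
  (vabs R t < ((Mr i)^-1)%:E)%E.
Proof.
move=> t0 ik0 tk0.
have nn k : (0 <= ((t k : nat)%:R / Mr k.+1)%:E)%E by rewrite lee_fin divr_ge0 ?ler0n.
apply: (@le_lt_trans _ _ ((Mr i)^-1 - (Mr k0.+1)^-1)%:E); last first.
  by rewrite lte_fin ltrBlDr ltrDl invr_gt0.
apply: lime_le; first by apply: is_cvg_nneseries => k _ _; exact: nn.
exists k0.+1 => // K /= k0K; rewrite sumEFin lee_fin.
have := vabs_partial_sum t0 ik0 tk0 (ltnW (leq_ltn_trans ik0 k0K)).
rewrite k0K mul1r lerBrDr; apply: le_trans.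
by rewrite lerD2r lerDl invr_ge0 ltW.
Qed.

Variable mu : probability (vilenkin m) R.
Hypothesis mu_haar : is_haar mu.

(* The exceptional point with [t k = 0] for [k < i] and [t k = m k - 1]
   afterwards has [vabs t] exactly equal to the inverse of [M i]. *)
Lemma ae_vabs_lt i :
  \forall t \ae mu, (forall k, (k < i)%N -> t k = 0) ->
    (vabs R t < ((Mr i)^-1)%:E)%E.
Proof.
(* In ['Z_(m k)] the element [-1] is the largest digit. The first [i] coordinates are left free, so
   [N] is larger than the exceptional point, but every further coordinate contributes a factor at
   most 1/2 to the measure. *)
pose A : forall k, {set 'Z_(m k)} :=
  fun k => if (k < i)%N then [set: 'Z_(m k)]%SET else [set -1]%SET.
pose N := \bigcap_n rectangle n A.
have mN : measurable N.
  by apply: bigcapT_measurable => n; exact: measurable_rectangle.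
have Nle n : (mu N <= (2^-1 ^+ n)%:E)%E.
  apply: (@le_trans _ _ (mu (rectangle (i + n) A))).
    apply: le_measure; rewrite ?inE//; first exact: measurable_rectangle.
    by move=> x; apply.
  rewrite [leLHS](mu_haar (i + n) A) lee_fin.
  have pos k : 0 <= #|A k|%:R / (m k)%:R :> R by rewrite divr_ge0.
  have le1 k : #|A k|%:R / (m k)%:R <= 1 :> R.
    rewrite ler_pdivrMr ?ltr0n ?m_gt0// mul1r ler_nat.
    by rewrite (leq_trans (max_card _))// card_ord Zp_cast.
  rewrite -(big_mkord xpredT (fun k => #|A k|%:R / (m k)%:R)).
  rewrite (big_cat_nat (leq0n i) (leq_addr _ _))/=.
  have P1 : \prod_(0 <= k < i) (#|A k|%:R / (m k)%:R) <= 1 :> R.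
    by apply: prodr_ile1 => k _; rewrite pos le1.
  have P2 : \prod_(i <= k < i + n) (#|A k|%:R / (m k)%:R) <= 2^-1 ^+ n :> R.
    rewrite [X in index_iota X _](_ : i = 0 + i)%N// big_addn addKn.
    rewrite -[X in _ ^+ X]subn0 -prodr_const_nat.
    apply: ler_prod => k _; rewrite pos/= /A ltnNge leq_addl/= cards1 mul1r.
    by rewrite lef_pV2 ?posrE ?ltr0n ?(m_gt0 m_ge2)// (ler_nat _ 2).
  rewrite -[leRHS]mul1r ler_pM//; apply: prodr_ge0 => k _; exact: pos.
have N0 : mu N = 0%E.
  apply/eqP; rewrite eq_le measure_ge0 andbT.
  apply/lee_addgt0Pr => e e0; rewrite add0e.
  have [n ne] : exists n, 2^-1 ^+ n <= e.
    have /cvgr0Pnorm_le/(_ _ e0)[n _ H] :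
        (fun n => 2^-1 ^+ n : R) @ \oo --> (0 : R).
      by apply: cvg_expr; rewrite ger0_norm ?invr_ge0// invf_lt1// ltr1n.
    by exists n; have /= := H n (leqnn n); rewrite ger0_norm// exprn_ge0 ?invr_ge0.
  by apply: le_trans (Nle n) _; rewrite lee_fin.
(* A bad [t] must have the largest digit at every [k >= i]: any other digit could serve as [k0] in
   [vabs_lt]. *)
exists N; split => // t /= /not_implyP[t0 tlt] n _ k kn; rewrite /A.
case: ltnP => ik; first by rewrite inE.
rewrite inE; apply/negPn/negP => tk; apply: tlt; apply: (vabs_lt t0 ik).
rewrite ltn_neqAle (Zp_ltn m_ge2) andbT; apply: contra tk => /eqP tk.
by rewrite -addr_eq0 -(natr_Zp (t k)) natr1 tk pchar_Zp.
Qed.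

End modulus.

(** * Partial sums as projections and as convolutions *)

Section approximation.
Local Open Scope complex_scope.
Variables (R : realType) (m : nat -> nat).
Hypothesis m_ge2 : forall k, (2 <= m k)%N.
Variable mu : probability (vilenkin m) R.
Hypothesis mu_haar : is_haar mu.
Implicit Types (f g W : vilenkin m -> R[i]) (x y t : vilenkin m).

Local Notation psi := (@vpsi R m).
Local Notation D := (@dirichlet R m).
Local Notation M := (Mseq m).
Local Notation S := (partial_sum mu).

Lemma cintegrable_fourier f k : cintegrable mu f ->
  cintegrable mu (fun x => f x * conjc (psi k x)).
Proof.
move=> fi; apply: (@cintegrableM_bounded _ _ _ _ _ 1) => //.
  by apply: cmeasurable_conj; exact: cmeasurable_vpsi.
by move=> x; rewrite normc_conj normc_vpsi.
Qed.

Lemma cmeasurable_partial_sum k f : cmeasurable (S k f).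
Proof.
apply: (@cmeasurable_sum _ _ _ _ _ _ (fun (l : 'I_k) x =>
  fourier mu f l * psi l x)) => l.
by apply: cmeasurableM; [exact: cmeasurable_cst|exact: cmeasurable_vpsi].
Qed.

Lemma fourierD f g k : cintegrable mu f -> cintegrable mu g ->
  fourier mu (fun x => f x + g x) k = fourier mu f k + fourier mu g k.
Proof.
move=> fi gi; rewrite /fourier -cintegralD; [|exact: cintegrable_fourier..].
by congr cintegral; apply/funext => x; rewrite mulrDl.
Qed.

Lemma fourierZ z f k : cintegrable mu f ->
  fourier mu (fun x => z * f x) k = z * fourier mu f k.
Proof.
move=> fi; rewrite /fourier -cintegralZ; last exact: cintegrable_fourier.
by congr cintegral; apply/funext => x; rewrite mulrA.
Qed.

Lemma cintegrable_vpsi k : cintegrable mu (psi k).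
Proof.
apply: (@cintegrable_bounded _ _ _ _ 1); first exact: cmeasurable_vpsi.
by move=> x; rewrite normc_vpsi.
Qed.

Lemma cintegrable_partial_sum k f : cintegrable mu (S k f).
Proof.
apply: (@cintegrable_sum _ _ _ _ _ _ (fun (l : 'I_k) x =>
  fourier mu f l * psi l x)) => l.
by apply: cintegrableZ; exact: cintegrable_vpsi.
Qed.

Lemma fourier_partial_sum k f l :
  fourier mu (S k f) l = (l < k)%:R * fourier mu f l.
Proof.
rewrite /fourier (_ : (fun x => _) = (fun x => \sum_(j < k)
    fourier mu f j * (psi j x * conjc (psi l x)))); last first.
  by apply/funext => x; rewrite mulr_suml; apply: eq_bigr => j _; rewrite mulrA.
have ji j : cintegrable mu (fun x => psi j x * conjc (psi l x)).
  by apply: cintegrable_fourier; exact: cintegrable_vpsi.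
rewrite (@cintegral_sum _ _ _ _ _ _ (fun (j : 'I_k) x =>
  fourier mu f j * (psi j x * conjc (psi l x)))); last first.
  by move=> j; exact: cintegrableZ.
under eq_bigr do rewrite cintegralZ// vpsi_orthonormal//.
have [lk|kl] := ltnP l k.
  rewrite (bigD1 (Ordinal lk))//= eqxx mulr1 mul1r big1 ?addr0// => j jl.
  by rewrite -(inj_eq val_inj) /= in jl; rewrite (negPf jl) mulr0.
rewrite mul0r big1// => j _.
by rewrite ltn_eqF ?mulr0// (leq_trans (ltn_ord j)).
Qed.

(** Orthonormality cuts the Fourier coefficients of [S n f] at [n]. The minimum lets one formula
    serve both [k <= n], where the result vanishes, and [k >= n]. *)
Lemma partial_sum_residual k n f x : cintegrable mu f ->
  S k (fun y => f y - S n f y) x = S k f x - S (minn k n) f x.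
Proof.
move=> fi; have ni := cintegrable_partial_sum n f.
have E l : fourier mu (fun y => f y - S n f y) l =
    fourier mu f l - (l < n)%:R * fourier mu f l.
  rewrite -fourier_partial_sum -mulN1r -fourierZ// -fourierD//.
    apply: (congr1 (fun h => fourier mu h l)); apply/funext => y.
    by rewrite mulN1r.
  exact: cintegrableZ.
rewrite /partial_sum; under eq_bigr do rewrite E mulrBl.
rewrite sumrB; congr (_ - _).
rewrite -(big_mkord xpredT (fun l => (l < n)%:R * fourier mu f l * psi l x)).
rewrite -(big_mkord xpredT (fun l => fourier mu f l * psi l x)).
rewrite (big_cat_nat (leq0n _) (geq_minl k n))/= [X in _ + X]big1_seq ?addr0.
  rewrite big_nat [RHS]big_nat; apply: eq_bigr => l /andP[_].
  by rewrite leq_min => /andP[_ ->]; rewrite mul1r.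
move=> l; rewrite mem_index_iota geq_min => /andP[_ /andP[kl lk]].
by rewrite ltnNge (_ : (n <= l)%N) ?mul0r//; case/orP: kl; lia.
Qed.

Lemma dirichlet_bounded k x : normc (D k x) <= k%:R.
Proof.
apply: le_trans (normc_sum _ _ _) _.
under eq_bigr do rewrite normc_vpsi//.
by rewrite sumr_const card_ord.
Qed.

Lemma measurable_opp_translate x :
  measurable_fun setT (fun y : vilenkin m => x - y).
Proof.
apply: measurable_fun_vilenkin => k A.
rewrite (_ : [set _ | _] = [set y : vilenkin m | y k \in [set a | (x k - a)%R \in A]%SET]).
  exact: measurable_coord.
by apply/seteqP; split => y /=; rewrite inE.
Qed.

Lemma cintegrable_conv f W C x : cintegrable mu f -> cmeasurable W ->
  (forall y, normc (W y) <= C) -> cintegrable mu (fun y => f y * W (x - y)).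
Proof.
move=> fi mW WC; apply: (@cintegrableM_bounded _ _ _ _ _ C) => //.
by apply: (cmeasurable_comp _ mW); exact: measurable_opp_translate.
Qed.

Lemma partial_sumE k f x : cintegrable mu f ->
  S k f x = cintegral mu (fun y => f y * D k (x - y)).
Proof.
move=> fi; rewrite (_ : (fun y => _) = (fun y => \sum_(l < k)
    psi l x * (f y * conjc (psi l y)))); last first.
  apply/funext => y; rewrite mulr_sumr; apply: eq_bigr => l _.
  by rewrite vpsiD// conjc_vpsi// mulrCA mulrA.
rewrite (@cintegral_sum _ _ _ _ _ _ (fun (l : 'I_k) y =>
  psi l x * (f y * conjc (psi l y)))); last first.
  by move=> l; apply: cintegrableZ; exact: cintegrable_fourier.
apply: eq_bigr => l _; rewrite cintegralZ 1?mulrC//.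
exact: cintegrable_fourier.
Qed.

Lemma sum_partial_sumE (w : nat -> R) K f x : cintegrable mu f ->
  \sum_(k < K) (w k)%:C * S k.+1 f x =
  cintegral mu (fun y => f y * \sum_(k < K) (w k)%:C * D k.+1 (x - y)).
Proof.
move=> fi; rewrite (_ : (fun y => _) = (fun y => \sum_(k < K)
    (w k)%:C * (f y * D k.+1 (x - y)))); last first.
  apply/funext => y; rewrite mulr_sumr; apply: eq_bigr => k _.
  by ring.
have ki k : cintegrable mu (fun y => f y * D k (x - y)).
  apply: (cintegrable_conv _ fi); last exact: dirichlet_bounded.
  exact: cmeasurable_dirichlet.
rewrite (@cintegral_sum _ _ _ _ _ _ (fun (k : 'I_K) y =>
  (w k)%:C * (f y * D k.+1 (x - y)))); last first.
  by move=> k; exact: cintegrableZ.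
by apply: eq_bigr => k _; rewrite cintegralZ// partial_sumE.
Qed.

(** The substitution [y = x + t] moves the dependence on [x] into translates of [f], the shape
    [integral_minkowski] expects. *)
Lemma normc_conv f W x : cmeasurable f -> cmeasurable W ->
  cintegrable mu (fun y => f y * W (x - y)) ->
  ((normc (cintegral mu (fun y => f y * W (x - y))))%:E <=
   \int[mu]_t (normc (f (x + t)%R) * normc (W (- t)%R))%:E)%E.
Proof.
move=> mf mW fi; apply: le_trans (normc_cintegral fi) _.
rewrite -(integral_translate mu_haar x (g := fun y => (normc (f y * W (x - y)))%:E)).
  rewrite le_eqVlt; apply/orP; left; apply/eqP/eq_integral => t _.
  by rewrite normcM [t + x]addrC opprD addNKr.
by apply/measurable_EFinP; apply: measurable_normc; case: fi.
Qed.

(** Lets the number [f x] be written as a partial sum, so that [S k f x - f x] becomes a convolution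
    of [f - f x]. *)
Lemma partial_sum_cst k z x : (0 < k)%N -> S k (fun=> z) x = z.
Proof.
case: k => // k _; rewrite /partial_sum big_ord_recl/= vpsi0 mulr1.
have F l : fourier mu (fun=> z) l = z * (0%N == l)%:R.
  rewrite -(vpsi_orthonormal m_ge2 mu_haar) -cintegralZ.
    by congr cintegral; apply/funext => y; rewrite vpsi0 mul1r.
  by apply: cintegrable_fourier; exact: cintegrable_vpsi.
rewrite F mulr1 big1 ?addr0// => l _.
by rewrite F mulr0 mul0r.
Qed.

End approximation.

(** * Block estimates *)

Section norlund_estimate.
Local Open Scope complex_scope.
Variables (R : realType) (m : nat -> nat).
Hypothesis m_ge2 : forall k, (2 <= m k)%N.
Variable mu : probability (vilenkin m) R.
Hypothesis mu_haar : is_haar mu.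
Variable p : R.
Hypothesis p_ge1 : 1 <= p.
Implicit Types (f g W : vilenkin m -> R[i]) (x y t : vilenkin m).

Local Notation psi := (@vpsi R m).
Local Notation D := (@dirichlet R m).
Local Notation M := (Mseq m).
Local Notation S := (partial_sum mu).

Lemma partial_sumD k f g x : cintegrable mu f -> cintegrable mu g ->
  S k (fun y => f y + g y) x = S k f x + S k g x.
Proof.
move=> fi gi; rewrite /partial_sum -big_split; apply: eq_bigr => l _.
by rewrite fourierD// mulrDl.
Qed.

Lemma dirichletN k t : D k (- t) = conjc (D k t).
Proof.
rewrite /dirichlet rmorph_sum; apply: eq_bigr => l _.
by rewrite [RHS]conjc_vpsi.
Qed.

Lemma cintegrable_cst (z : R[i]) : cintegrable mu (fun=> z).
Proof.
by apply: (@cintegrable_bounded _ _ _ _ (normc z)) => //; exact: cmeasurable_cst.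
Qed.

Lemma modulus_ge0 delta f : 0 < delta -> (0 <= modulus mu p delta f)%E.
Proof.
move=> d0; apply: le_trans (Lpnorm_ge0 mu p (fun x => f (x + 0) - f x)) _.
apply: ereal_sup_ubound; exists 0 => //=.
by rewrite /vabs eseries0 ?lte_fin// => k _ _; rewrite mul0r.
Qed.

(** Translation invariance bounds the modulus by twice the norm of [f]. Finiteness allows it to be
    used as the real constant [c] of [integral_minkowski]. *)
Lemma modulus_fin_num delta f : 0 < delta -> in_Lp mu p f ->
  modulus mu p delta f \is a fin_num.
Proof.
move=> d0 fp; have mf := in_Lp_cmeasurable fp.
rewrite ge0_fin_numE; last exact: modulus_ge0.
apply: (@le_lt_trans _ _ (Lpnorm mu p f + Lpnorm mu p f)%E); last first.
  by case: fp => _ _ fp; exact: lte_add_pinfty.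
apply: ge_ereal_sup => _ [t _ <-].
have mft : cmeasurable (fun x => f (x + t)).
  by apply: (cmeasurable_comp _ mf); exact: measurable_translate.
have mNf : cmeasurable (fun x => - f x).
  under eq_fun do rewrite -mulN1r.
  by apply: cmeasurableM => //; exact: cmeasurable_cst.
apply: le_trans (LpnormD mu p_ge1 mft mNf) _.
rewrite (Lpnorm_translate _ mu_haar)//; apply: leeD2l.
rewrite (_ : (fun x => _) = fun x => -1 * f x).
  by rewrite LpnormZ// normc_opp normc1 mul1e.
by apply/funext => x; rewrite mulN1r.
Qed.

Lemma Lpnorm_residual i f : in_Lp mu p f ->
  (Lpnorm mu p (fun x => f x - S (M i) f x)%R <=
   modulus mu p ((M i)%:R)^-1 f)%E.
Proof.
move=> fp; have mf := in_Lp_cmeasurable fp; have fi := in_Lp_cintegrable p_ge1 fp.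
have Mi0 : 0 < ((M i)%:R)^-1 :> R by rewrite invr_gt0 ltr0n Mseq_gt0.
have fin := modulus_fin_num Mi0 fp.
rewrite -(fineK fin) -[fine _]mulr1.
have mD := @cmeasurable_dirichlet R m (M i).
apply: (@integral_minkowski _ _ _ _ _ mu mu
  (fun x => normc (f x - S (M i) f x))
  (fun z => normc (f (z.1 + z.2) - f z.1)) (fun t => normc (D (M i) t))) => //.
- by rewrite fine_ge0// modulus_ge0.
- apply: measurable_normc; apply: cmeasurableB => //.
  exact: cmeasurable_partial_sum.
- by move=> x; exact: normc_ge0.
- apply: measurable_normc; apply: cmeasurableB.
    by apply: (cmeasurable_comp _ mf); exact: measurable_vadd.
  by apply: (cmeasurable_comp _ mf); exact: measurable_fst.
- by move=> z; exact: normc_ge0.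
- exact: measurable_normc.
- by move=> t; exact: normc_ge0.
- by have := L1norm_dirichlet_Mseq m_ge2 mu_haar i; rewrite /L1norm => ->.
(* For fixed [x] the constant [f x] is subtracted before convolving, which produces the differences
   [f (x + t) - f x]. *)
- move=> x; pose h y := f y + - f x.
  have hi : cintegrable mu h by apply: cintegrableD => //; exact: cintegrable_cst.
  have E : S (M i) f x - f x = S (M i) h x.
    rewrite partial_sumD//; last exact: cintegrable_cst.
    by rewrite partial_sum_cst// Mseq_gt0.
  rewrite -normc_opp opprB E partial_sumE//.
  apply: le_trans (normc_conv mu_haar _ mD _) _.
  + by case: hi.
  + apply: (cintegrable_conv _ hi mD); exact: dirichlet_bounded.
  rewrite le_eqVlt; apply/orP; left; apply/eqP/eq_integral => t _ /=.
  by rewrite dirichletN normc_conj.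
(* Where the kernel is nonzero, the first [i] coordinates of [t] vanish, and then almost every such
   [t] lies in the open ball of the modulus. *)
- apply: (@filterS _ _ (ae_filter_ringOfSetsType mu) _ _ _
    (ae_vabs_lt m_ge2 mu_haar i)) => t tlt Dt.
  rewrite fineK//; apply: ereal_sup_ubound; exists t => //=; apply: tlt => k ki.
  move: Dt; rewrite dirichlet_Mseq//; case: forallP => [/(_ (Ordinal ki))/eqP//|_].
  by rewrite muln0 normc0 eqxx.
Qed.

Lemma in_Lp_residual i f : in_Lp mu p f -> in_Lp mu p (fun x => f x - S (M i) f x).
Proof.
move=> fp; have mf := in_Lp_cmeasurable fp.
have [m1 m2] := cmeasurableB mf (cmeasurable_partial_sum mu (M i) f).
split => //; apply: le_lt_trans (Lpnorm_residual i fp) _.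
by rewrite ltey_eq modulus_fin_num// invr_gt0 ltr0n Mseq_gt0.
Qed.

Variable B : R.
Hypothesis m_leB : forall k, (m k)%:R <= B.

(** The weighted sum is a convolution of [g] with one kernel, and all translates of [g] have the
    same norm, so the [L^1] bound on that kernel gives the estimate. *)
Lemma Lpnorm_weighted_partial_sum g (a : R) (w : nat -> R) K s :
  in_Lp mu p g -> 0 <= a -> (Lpnorm mu p g <= a%:E)%E ->
  (forall k, 0 <= w k) -> 0 < w 0%N -> (forall k, w k.+1 <= w k) ->
  (K < M s.+1)%N ->
  (Lpnorm mu p (fun x => \sum_(k < K) (w k)%:C * S k.+1 g x)%R <=
   (a * (w 0%N * (3 * B ^+ 2 * (M s)%:R)))%:E)%E.
Proof.
move=> gp a0 ga w0 w00 wd KM.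
have mg := in_Lp_cmeasurable gp; have gi := in_Lp_cintegrable p_ge1 gp.
have B0 : 0 < B by apply: lt_le_trans (m_leB 0); rewrite ltr0n m_gt0.
have M0 : 0 < (M s)%:R :> R by rewrite ltr0n Mseq_gt0.
pose W x := \sum_(k < K) (w k)%:C * D k.+1 x.
have mW : cmeasurable W.
  apply: (@cmeasurable_sum _ _ _ _ _ _ (fun (k : 'I_K) x => (w k)%:C * D k.+1 x)) => k.
  by apply: cmeasurableM; [exact: cmeasurable_cst|exact: cmeasurable_dirichlet].
have WN t : W (- t) = conjc (W t).
  rewrite /W rmorph_sum; apply: eq_bigr => k _.
  by rewrite dirichletN rmorphM; congr (_ * _); rewrite /= oppr0.
have WC x : normc (W x) <= \sum_(k < K) w k * k.+1%:R.
  apply: le_trans (normc_sum _ _ _) _; apply: ler_sum => k _.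
  by rewrite normcM normc_real ger0_norm// ler_wpM2l// dirichlet_bounded.
apply: (@integral_minkowski _ _ _ _ _ mu mu
  (fun x => normc (\sum_(k < K) (w k)%:C * S k.+1 g x))
  (fun z => normc (g (z.1 + z.2))) (fun t => normc (W t))) => //.
- by rewrite !mulr_gt0// exprn_gt0.
- apply: measurable_normc; apply: (@cmeasurable_sum _ _ _ _ _ _
    (fun (k : 'I_K) x => (w k)%:C * S k.+1 g x)) => k.
  by apply: cmeasurableM; [exact: cmeasurable_cst|exact: cmeasurable_partial_sum].
- by move=> x; exact: normc_ge0.
- apply: measurable_normc.
  by apply: (cmeasurable_comp _ mg); exact: measurable_vadd.
- by move=> z; exact: normc_ge0.
- exact: measurable_normc.
- by move=> t; exact: normc_ge0.
- apply: L1norm_sum_dirichlet_decreasing => // j jK.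
  by apply: L1norm_fejer => //; exact: leq_ltn_trans KM.
- move=> x; rewrite sum_partial_sumE//.
  apply: le_trans (normc_conv mu_haar mg mW _) _.
    exact: (cintegrable_conv _ gi mW WC).
  rewrite le_eqVlt; apply/orP; left; apply/eqP/eq_integral => t _ /=.
  by rewrite WN normc_conj.
- apply: aeW => t _; rewrite (_ : Lnorm _ _ _ = Lpnorm mu p (fun x => g (x + t)))//.
  by rewrite Lpnorm_translate.
Qed.

(** The two summands of the factor bound the weighted sum of the [S k g] and the total weight
    carried by [g] itself. As [e] is exclusive, the top index [e - 1] is strictly below [M i.+1],
    the range of [L1norm_fejer]. *)
Lemma Lpnorm_block f (v : nat -> R) i e :
  in_Lp mu p f -> (forall k, 0 <= v k) -> 0 < v (M i) ->
  (forall j k, (j <= k)%N -> v k <= v j) ->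
  (M i <= e <= M i.+1)%N ->
  (Lpnorm mu p (fun x => \sum_(M i <= k < e) (v k)%:C * (S k f x - f x))%R <=
   (v (M i) * (3 * B ^+ 2 * (M i)%:R) + \sum_(M i <= k < e) v k)%:E *
   modulus mu p ((M i)%:R)^-1 f)%E.
Proof.
move=> fp v0 vM vd /andP[Me eM].
have fi := in_Lp_cintegrable p_ge1 fp.
have Mi0 : 0 < ((M i)%:R)^-1 :> R by rewrite invr_gt0 ltr0n Mseq_gt0.
have fin := modulus_fin_num Mi0 fp.
have om0 := fine_ge0 (modulus_ge0 f Mi0).
have res := Lpnorm_residual i fp.
move: res; rewrite -(fineK fin); set om := fine _ => res.
pose g x := f x - S (M i) f x; have gp : in_Lp mu p g by exact: in_Lp_residual.
have mg := in_Lp_cmeasurable gp.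
have M1 : (0 < M i)%N by exact: Mseq_gt0.
have e0 : (0 < e)%N by exact: leq_trans Me.
(* The shift matches [S k.+1]. Freezing the weight below [M i] spares the boundary term
   [- v (M i) * F_(M i - 1)] that Abel summation from [M i] would leave. *)
pose w k := v (maxn k.+1 (M i)).
rewrite (_ : (fun x => _) = fun x =>
    \sum_(k < e.-1) (w k)%:C * S k.+1 g x +
    (- \sum_(M i <= k < e) v k)%:C * g x); last first.
  apply/funext => x.
  transitivity (\sum_(M i <= k < e) ((v k)%:C * S k g x + - (v k)%:C * g x)).
    apply: eq_big_nat => k /andP[Mk _]; rewrite partial_sum_residual//.
    by rewrite (minn_idPr Mk) /g; ring.
  rewrite big_split/= -mulr_suml; congr (_ + _ * _); last first.
    by rewrite rmorphN rmorph_sum sumrN.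
  rewrite -(big_mkord xpredT (fun k => (w k)%:C * S k.+1 g x)).
  rewrite -(big_add1 _ _ 0 e xpredT (fun k => (v (maxn k (M i)))%:C * S k g x)).
  rewrite [RHS](big_cat_nat M1 Me)/= [X in _ = X + _]big1_seq ?add0r.
    by apply: eq_big_nat => k /andP[Mk _]; rewrite (maxn_idPl Mk).
  move=> k; rewrite mem_index_iota => /andP[_ /andP[_ kM]].
  by rewrite partial_sum_residual// (minn_idPl (ltnW kM)) subrr mulr0.
have mS : cmeasurable (fun x => \sum_(k < e.-1) (w k)%:C * S k.+1 g x).
  apply: (@cmeasurable_sum _ _ _ _ _ _
    (fun (k : 'I_e.-1) x => (w k)%:C * S k.+1 g x)) => k.
  by apply: cmeasurableM; [exact: cmeasurable_cst|exact: cmeasurable_partial_sum].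
apply: le_trans (LpnormD mu p_ge1 mS _) _.
  by apply: cmeasurableM => //; exact: cmeasurable_cst.
rewrite LpnormZ// normc_real normrN ger0_norm; last by apply: sumr_ge0.
rewrite -EFinM mulrDl EFinD; apply: leeD; last first.
  by rewrite EFinM; apply: lee_wpmul2l => //; rewrite lee_fin sumr_ge0.
have w0 : w 0%N = v (M i) by rewrite /w (maxn_idPr M1).
rewrite mulrC -w0; apply: Lpnorm_weighted_partial_sum => //.
- by move=> k; exact: v0.
- by rewrite w0.
- by move=> k; apply: vd; lia.
- by rewrite prednK.
Qed.

End norlund_estimate.

(** * Assembling the blocks *)

Lemma msup_ge (R : realType) (m : nat -> nat) k :
  (exists B : nat, forall k, (m k <= B)%N) -> (m k)%:R <= msup R m.
Proof.
move=> [B mB]; apply: ub_le_sup; last by exists k.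
by exists B%:R => _ [j _ <-]; rewrite ler_nat.
Qed.

Lemma sum_Mseq_blocks (V : zmodType) (m : nat -> nat) (F : nat -> V) N :
  (forall k, (2 <= m k)%N) ->
  \sum_(1 <= k < Mseq m N) F k =
  \sum_(i < N) \sum_(Mseq m i <= k < Mseq m i.+1) F k.
Proof.
move=> m_ge2; elim: N => [|N IH].
  by rewrite big_ord0 /Mseq big_ord0 big_geq.
rewrite big_ord_recr/= -IH -big_cat_nat//; first exact: Mseq_gt0.
exact: leq_Mseq.
Qed.

Unset Implicit Arguments.
Set Strict Implicit.
Set Printing Implicit Defensive.

Theorem theorem1 (R : realType) (m : nat -> nat)
  (m_ge2 : forall k : nat, (2 <= m k)%N)
  (m_bounded : exists B : nat, forall k : nat, (m k <= B)%N)
  (mu : probability (vilenkin m) R) (mu_haar : is_haar mu)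
  (q : nat -> R)
  (q_ge0 : forall k : nat, 0 <= q k) (q0_gt0 : 0 < q 0%N)
  (q_nondecreasing : nondecreasing_seq q)
  (Q_cvg : Qsum q @ \oo --> +oo)
  (q_regular : norlund_regular q)
  (p : R) (p_ge1 : 1 <= p)
  (f : vilenkin m -> R[i]) (f_Lp : in_Lp mu p f)
  (N n : nat) (Nn : (Mseq m N <= n < Mseq m N.+1)%N) :
  (Lpnorm mu p (fun x => (norlund_fun mu q n f x - f x)%R) <=
   (3 * msup R m ^+ 3 / Qsum q n)%:E *
     \sum_(i < N) ((Mseq m i)%:R * q (n - Mseq m i)%N)%:E *
                  modulus mu p ((Mseq m i)%:R)^-1 f +
   (2 * msup R m ^+ 3)%:E * modulus mu p ((Mseq m N)%:R)^-1 f)%E.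
Proof.
pose B := msup R m; rewrite -/B.
have m_leB k : (m k)%:R <= B by exact: msup_ge.
have B2 : 2 <= B by exact: bound_ge2 m_leB.
have M_gt0 k : (0 < Mseq m k)%N by exact: Mseq_gt0.
have /andP[Mn nM] := Nn.
(* Truncated subtraction makes [v k = q 0] for [k > n], so [v] is positive and nonincreasing on all
   naturals, as the block lemma requires. *)
pose v k : R := q (n - k)%N.
have v_gt0 k : 0 < v k.
  by apply: lt_le_trans q0_gt0 _; exact: q_nondecreasing.
have v_ge0 k : 0 <= v k by exact: ltW.
have v_anti j k : (j <= k)%N -> v k <= v j.
  by move=> jk; apply: q_nondecreasing; rewrite leq_sub2l.
have Qv : \sum_(1 <= k < n.+1) v k = Qsum q n by exact: Qsum_rev.
have n_gt0 : (0 < n)%N by exact: leq_trans Mn.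
have Q_gt0 : 0 < Qsum q n by rewrite -(prednK n_gt0) Qsum_gt0.
have om_fin i : modulus mu p ((Mseq m i)%:R)^-1 f \is a fin_num.
  by apply: modulus_fin_num => //; rewrite invr_gt0 ltr0n.
pose om i := fine (modulus mu p ((Mseq m i)%:R)^-1 f).
have omE i : modulus mu p ((Mseq m i)%:R)^-1 f = (om i)%:E by rewrite fineK.
have om_ge0 i : 0 <= om i.
  by rewrite fine_ge0// modulus_ge0// invr_gt0 ltr0n.
(* The last block stops at [n], possibly before [M N.+1]. *)
pose e i := if i == N then n.+1 else Mseq m i.+1.
pose F k x : R[i] := real_complex R (v k) * (partial_sum mu k f x - f x).
have mf := in_Lp_cmeasurable f_Lp.
have mF k : cmeasurable (F k).
  apply: cmeasurableM; first exact: cmeasurable_cst.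
  by apply: cmeasurableB => //; exact: cmeasurable_partial_sum.
pose blk i x := \sum_(Mseq m i <= k < e i) F k x.
have mblk i : cmeasurable (blk i) by exact: cmeasurable_sum.
(* The weights add up to [Qsum q n], so [f] can be subtracted inside the mean, term by term. *)
have normE x : norlund_fun mu q n f x - f x =
    real_complex R (Qsum q n)^-1 * \sum_(i < N.+1) blk i x.
  have Qn0 : real_complex R (Qsum q n) != 0 :> R[i].
    by rewrite -(rmorph0 (real_complex R)) (inj_eq (@complexI R)) gt_eqF.
  rewrite /norlund_fun; transitivity (real_complex R (Qsum q n)^-1 *
      (\sum_(1 <= k < n.+1) real_complex R (v k) * partial_sum mu k f x -
       real_complex R (Qsum q n) * f x)).
    rewrite mulrBr; congr (_ - _).
    by rewrite mulrA -rmorphM mulVf ?gt_eqF// rmorph1 mul1r.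
  congr (_ * _); rewrite -Qv rmorph_sum mulr_suml -sumrB.
  transitivity (\sum_(1 <= k < n.+1) F k x).
    by apply: eq_bigr => k _; rewrite /F mulrBr.
  rewrite (@big_cat_nat _ _ _ (Mseq m N))//=; last exact: leqW.
  rewrite sum_Mseq_blocks// big_ord_recr/= /blk /e eqxx; congr (_ + _).
  by apply: eq_bigr => i _; rewrite (ltn_eqF (ltn_ord i)).
have e_block i : (i <= N)%N -> (Mseq m i <= e i <= Mseq m i.+1)%N.
  rewrite /e leq_eqVlt => /predU1P[->|iN]; rewrite ?eqxx.
    by rewrite leqW.
  by rewrite (ltn_eqF iN) leqnn andbT leq_Mseq.
pose c i : R := v (Mseq m i) * (3 * B ^+ 2 * (Mseq m i)%:R) +
  \sum_(Mseq m i <= k < e i) v k.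
have blk_le i : (i <= N)%N -> (Lpnorm mu p (blk i) <= (c i * om i)%:E)%E.
  move=> iN; rewrite EFinM -omE.
  exact: (Lpnorm_block m_ge2 mu_haar p_ge1 m_leB f_Lp v_ge0 (v_gt0 _) v_anti
    (e_block i iN)).
rewrite (_ : (fun x => _) =
    fun x => real_complex R (Qsum q n)^-1 * \sum_(i < N.+1) blk i x); last first.
  by apply/funext => x; exact: normE.
rewrite LpnormZ//; last exact: cmeasurable_sum.
have Qi_ge0 : 0 <= (Qsum q n)^-1 by rewrite invr_ge0 ltW.
rewrite normc_real ger0_norm//.
apply: (@le_trans _ _ (((Qsum q n)^-1)%:E * \sum_(i < N.+1) (c i * om i)%:E)%E).
  apply: lee_wpmul2l; first by rewrite lee_fin.
  apply: le_trans (Lpnorm_sum mu p_ge1 N.+1 mblk) _.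
  by apply: lee_sum => i _; apply: blk_le; rewrite -ltnS.
under [X in (_ <= _ * X + _)%E]eq_bigr do rewrite omE -EFinM.
rewrite omE !sumEFin -!EFinM -EFinD lee_fin big_ord_recr/= mulrDr.
(* The block has at most [M_(i+1) <= B M_i] terms, each with weight at most [v (M_i)]. *)
have cB i : (i < N)%N -> c i <= 3 * B ^+ 3 * ((Mseq m i)%:R * q (n - Mseq m i)%N).
  move=> iN; rewrite /c /e (ltn_eqF iN) -/(v (Mseq m i)).
  have Mi0 : 0 <= (Mseq m i)%:R :> R by rewrite ler0n.
  have S1 : \sum_(Mseq m i <= k < Mseq m i.+1) v k <= B * (Mseq m i)%:R * v (Mseq m i).
    apply: (@le_trans _ _ (\sum_(Mseq m i <= k < Mseq m i.+1) v (Mseq m i))).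
      by apply: ler_sum_nat => k /andP[Mk _]; exact: v_anti.
    rewrite sumr_const_nat -[leLHS]mulr_natl ler_wpM2r//.
    apply: (@le_trans _ _ (Mseq m i.+1)%:R); first by rewrite ler_nat leq_subr.
    by rewrite MseqS natrM ler_wpM2r.
  have vM : 0 <= v (Mseq m i) * (Mseq m i)%:R by rewrite mulr_ge0.
  have BB : 3 * B ^+ 2 + B <= 3 * B ^+ 3 by nra.
  have := ler_wpM2r vM BB; lra.
have cN : c N <= 2 * B ^+ 3 * Qsum q n.
  rewrite /c /e eqxx.
  have S1 : \sum_(Mseq m N <= k < n.+1) v k <= Qsum q n.
    rewrite -Qv [leRHS](@big_cat_nat _ _ _ (Mseq m N))//=; last exact: leqW.
    by rewrite lerDr sumr_ge0.
  (* Each of the [M_N] weights with index [1 <= k <= M_N] is at least [v (M_N)], and all of them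
     occur in [Qsum q n] because [M_N <= n]. *)
  have S2 : v (Mseq m N) * (Mseq m N)%:R <= Qsum q n.
    rewrite -Qv [leRHS](@big_cat_nat _ _ _ (Mseq m N).+1)//=.
    rewrite -[leLHS]addr0 lerD//; last exact: sumr_ge0.
    have -> : v (Mseq m N) * (Mseq m N)%:R =
        \sum_(1 <= k < (Mseq m N).+1) v (Mseq m N).
      by rewrite sumr_const_nat subn1 mulr_natr.
    by apply: ler_sum_nat => k /andP[_ kM]; exact: v_anti.
  have BB : 3 * B ^+ 2 + 1 <= 2 * B ^+ 3 by nra.
  have := ler_wpM2r (ltW Q_gt0) BB.
  have : 3 * B ^+ 2 * (v (Mseq m N) * (Mseq m N)%:R) <= 3 * B ^+ 2 * Qsum q n.
    by rewrite ler_wpM2l// mulr_ge0// sqr_ge0.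
  lra.
apply: lerD.
  rewrite [3 * _ / _]mulrC -mulrA ler_wpM2l// mulr_sumr.
  apply: ler_sum => i _; rewrite mulrA ler_wpM2r//.
  exact: cB.
rewrite mulrA ler_wpM2r// mulrC ler_pdivrMr//.
Qed.
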